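(* Let $f:\mathbb{R}^d\to\mathbb{R}$ be differentiable and $L$-smooth, i.e. $\|\nabla f(x)-\nabla f(y)\|\le L\|x-y\|$ for all $x,y\in\mathbb{R}^d$. Suppose there is $f^*\in\mathbb{R}$ with $f(x)\ge f^*$ for all $x\in\mathbb{R}^d$, and put $\Delta:=f(x^0)-f^*$, where $x^0$ is the starting point. Suppose every worker $i\in[n]$ can only calculate stochastic gradients $\nabla f(x;\xi)$ with $\mathbb{E}_\xi[\nabla f(x;\xi)]=\nabla f(x)$ and $\mathbb{E}_\xi[\|\nabla f(x;\xi)-\nabla f(x)\|^2]\le\sigma^2$ for all $x\in\mathbb{R}^d$, where $\sigma^2\ge 0$. Let $\varepsilon>0$. If $h_i=h$ for all $i\in[n]$, then, under the computation and communication model described in the context, the time complexity (in seconds) of Grace SGD (described in the context) for finding an $\varepsilon$-stationary point of $\min_{x\in\mathbb{R}^d}f(x)$ is $$\mathcal{O}\left(\min_{k\in[n]}\left(\frac{d}{\bar w_k}+\min_{p\in[k]}\frac{h\sigma^2}{|S_{k,p}|\,\varepsilon}\right)\frac{L\Delta}{\varepsilon}+\frac{hL\Delta}{\varepsilon}\right),$$ where $\{\bar w_k\}_{k\in[n]}$ and $\{S_{k,p}\}_{k\in[n],p\in[k]}$ are the sequences generated by the preprocessing procedure described in the context.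
   Context: Notation: $[n]=\{1,\dots,n\}$. An $\varepsilon$-stationary point is a (possibly random) point $\bar x\in\mathbb{R}^d$ with $\mathbb{E}[\|\nabla f(\bar x)\|^2]\le\varepsilon$. A method with iterates $x^0,x^1,\dots$ is said to find an $\varepsilon$-stationary point after $K$ iterations if a point chosen uniformly at random (independently) from $x^0,\dots,x^{K-1}$ is $\varepsilon$-stationary; Grace SGD is run for $K=\lceil 4L\Delta/\varepsilon\rceil$ iterations. For $S\subseteq[n]$, $\pi(S)$ is a permutation sorting $\{h_i\}_{i\in S}$ increasingly: $h_{\pi_1(S)}\le\dots\le h_{\pi_{|S|}(S)}$. The paper assumes $d$ is large. Computation model: worker $i\in[n]$ needs $h_i>0$ seconds to compute one stochastic gradient; workers compute in parallel, and random samples are i.i.d. Communication model: there is a directed connected weighted graph $G=(V,E,b)$ with $V=[n]$ (vertices are workers) such that $(i,j)\in E$ implies $(j,i)\in E$ and $b_{ij}=b_{ji}>0$; $b_{ij}$ is the number of coordinates/bits per second that worker $i$ can send to worker $j$ over edge $(i,j)$. Workers can send and receive simultaneously and asynchronously over all edges, overlap communication and computation, split vectors over several routes, interleave several streams on one edge, and an intermediate node may add incoming coordinates and forward the result immediately as coordinates arrive. There are no latencies; all operations other than stochastic gradient computations and transmissions take negligible (zero) time. The undirected version is $\bar G=(V,\bar E,b)$, where $\{i,j\}\in\bar E$ with weight $b_{ij}$ iff $(i,j),(j,i)\in E$ with weight $b_{ij}$. Cuts: for $U\subseteq V$, $\delta(U)$ is the set of edges of $\bar G$ with exactly one endpoint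 in $U$; the value of the cut $(U,V\setminus U)$ is $\sum_{e\in\delta(U)}b_e$. For $S\subseteq V$, an $S$-cut is a partition $(U,V\setminus U)$ with $U\cap S\ne\emptyset$ and $(V\setminus U)\cap S\neq\emptyset$; $\alpha_{\bar G}(S)$ is the minimum value of an $S$-cut. A Gomory–Hu tree of $\bar G$ is a weighted tree $T=(V,F,w)$ such that for every $\{i,j\}\in F$, if $W$ is one component of $T-\{i,j\}$, then $\delta(W)$ is a minimum $i$–$j$ cut in $\bar G$ and $w_{ij}$ is its value. Preprocessing procedure: construct a Gomory–Hu tree $T=(V,F,w)$ of $\bar G$; sort its $n-1$ edge weights $\bar w_1\le\dots\le\bar w_{n-1}$ and set $\bar w_n:=\infty$ (so $d/\bar w_n=0$). For $k=1,\dots,n$, let $\mathcal{S}_k=(S_{k,1},\dots,S_{k,k})$ be the vertex sets of the connected components of the forest obtained from $T$ by removing the edges corresponding to $\bar w_1,\dots,\bar w_{k-1}$. For $S\in\mathcal{S}_k$ put $t_k(S):=\frac{d}{\bar w_k}+\min_{m\in[|S|]}\big[\big(\frac1m\sum_{i=1}^m\frac1{h_{\pi_i(S)}}\big)^{-1}\big(1+\frac{\sigma^2}{\varepsilon m}\big)\big]$. The procedure returns a set $S^*\in\mathcal{S}_{k^*}$ minimizing $t_k(S)$ over all $k\in[n]$ and $S\in\mathcal{S}_k$. Grace SGD: find $S^*$ by the preprocessing procedure; the workers in $S^*$ start from $x^0$ with step size $\gamma=\frac1{2L}$. For $k=0,1,\dots$: (i) the workers in $S^*$ compute $\sum_{j=1}^{B_i}\nabla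 f(x^k;\xi^k_{ij})$ in parallel, each starting a new stochastic gradient as soon as the previous one is finished and increasing its local batch size $B_i$ over time, until $\sum_{i\in S^*}B_i=\max\{\lceil\sigma^2/\varepsilon\rceil,1\}$; (ii) they run an optimal-bandwidth AllReduce (below) so that all workers in $S^*$ obtain $\sum_{i\in S^*}\sum_{j=1}^{B_i}\nabla f(x^k;\xi^k_{ij})$; (iii) each worker in $S^*$ sets $x^{k+1}=x^k-\frac{\gamma}{\sum_{i\in S^*}B_i}\sum_{i\in S^*}\sum_{j=1}^{B_i}\nabla f(x^k;\xi^k_{ij})$. Optimal-bandwidth AllReduce for $S\subseteq V$ (worker $i\in S$ holds $a_i\in\mathbb{R}^d$; all workers of $S$ must obtain $\sum_{i\in S}a_i$; no communication is needed if $|S|=1$): bandwidths are taken to be integers (rational bandwidths are renormalized by a common denominator). Let $\hat G$ be the unweighted multigraph in which each $\{i,j\}\in\bar E$ is repeated $b_{ij}$ times, each copy with unit bandwidth (simulated by interleaving on the real edge). Once, as preprocessing, find edge-disjoint trees $\hat T_1,\dots,\hat T_p$ in $\hat G$, each connecting all vertices of $S$, with $p$ equal to $\alpha_{\bar G}(S)$ up to a universal constant factor (Steiner tree packing; a polynomial-time algorithm of Lau (2004) provides it), and fix a pivot $v\in S$. Each $i\in S$ splits $a_i$ into $p$ blocks of size $\lceil d/p\rceil$ (zero padding if needed). In parallel over $j\in[p]$, the $j$-th blocks are summed at $v$ along $\hat T_j$ with coordinate-by-coordinate streaming and aggregation at intermediate nodes; then the summed $j$-th block is broadcast from $v$ to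 $S$ along $\hat T_j$ in the same streaming manner. *)

(* Defs.v *)
From HB Require Import structures.
From mathcomp Require Import all_boot all_order all_algebra.
From mathcomp Require Import all_classical all_reals all_analysis.

Set Implicit Arguments.
Unset Strict Implicit.
Unset Printing Implicit Defensive.

Import Order.TTheory GRing.Theory Num.Theory.
Import numFieldNormedType.Exports.

Local Open Scope classical_set_scope.
Local Open Scope ring_scope.

Section Generic.
Variable R : realType.

(* Minimum of F over A. It is only used for finite nonempty A, where the
   infimum is attained. *)
Definition minimum (I : Type) (A : set I) (F : I -> R) : R :=
  inf [set F i | i in A].

(* Only used for x >= 0. *)
Definition ceiln (x : R) : nat := `|Num.ceil x|%N.

End Generic.

(* An undirected graph on V is given by its edges {u, v}, as two-element
   sets. *)
Section Graphs.
Variable V : finType.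

Definition adj (F : {set {set V}}) : rel V :=
  [rel u v | (u != v) && ([set u; v]%SET \in F)].

Definition component (F : {set {set V}}) (u : V) : {set V} :=
  [set v | connect (adj F) u v]%SET.

Definition components (F : {set {set V}}) : {set {set V}} :=
  [set component F u | u : V]%SET.

(* (N, F) is a tree. The size bound excludes cycles: ucycle also holds of the
   back-and-forth walk [:: u; v] along one edge. *)
Definition is_tree (N : {set V}) (F : {set {set V}}) : Prop :=
  [/\ N != finset.set0,
      forall e, e \in F -> #|e| = 2 /\ e \subset N,
      forall u v, u \in N -> v \in N -> connect (adj F) u v
    & forall c, ucycle (adj F) c -> (size c <= 2)%N].

(* In the tree F, w is the neighbour of u on the path from u to the pivot v. *)
Definition towards (F : {set {set V}}) (v u w : V) : bool :=
  adj F u w && connect (adj (F :\ [set u; w])%SET) w v.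

End Graphs.

Section Network.
Variables (R : realType) (V : finType).

(* Bandwidths of a connected graph whose edges are the pairs with b i j > 0;
   b i j = 0 means that there is no edge. *)
Definition network (b : V -> V -> R) : Prop :=
  [/\ forall i j, 0 <= b i j,
      forall i j, b i j = b j i,
      forall i, b i i = 0
    & forall i j, connect [rel i j | 0 < b i j] i j].

(* Value of the cut (U, V \ U): every undirected edge of delta(U) is counted
   once, from its endpoint in U. *)
Definition cut (b : V -> V -> R) (U : {set V}) : R :=
  \sum_(i in U) \sum_(j in (~: U)%SET) b i j.

(* alpha(S), for #|S| >= 2 *)
Definition steiner_mincut (b : V -> V -> R) (S : {set V}) : R :=
  minimum [set U : {set V} | (U :&: S)%SET != finset.set0 /\
                             (~: U :&: S)%SET != finset.set0] (cut b).

Definition gomory_hu_tree (b : V -> V -> R)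
    (F : {set {set V}}) (w : {set V} -> R) : Prop :=
  is_tree [set: V]%SET F /\
  forall i j, adj F i j ->
    let W := component (F :\ [set i; j])%SET i in
    (forall U : {set V}, i \in U -> j \notin U -> cut b W <= cut b U) /\
    w [set i; j]%SET = cut b W.

(* es lists the edges of F by nondecreasing weight, ties being broken
   arbitrarily. *)
Definition sorted_edges (F : {set {set V}}) (w : {set V} -> R)
    (es : seq {set V}) : Prop :=
  perm_eq es (enum F) /\ sorted (fun e e' => w e <= w e') es.

(* 1 / \bar w_k for k in 1..#|V|, with 1 / \bar w_#|V| = 1 / oo = 0 *)
Definition inv_wbar (w : {set V} -> R) (es : seq {set V}) (k : nat) : R :=
  if (k < #|V|)%N then (w (nth finset.set0 es k.-1))^-1 else 0.

(* The sets S_{k,1}, ..., S_{k,k}. *)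
Definition level (F : {set {set V}}) (es : seq {set V}) (k : nat) :
    {set {set V}} :=
  components [set e in F | e \notin take k.-1 es]%SET.

Definition sort_by (h : V -> R) (S : {set V}) : seq V :=
  sort (fun i j => h i <= h j) (enum S).

Definition comp_cost (h : V -> R) (sigma eps : R) (S : {set V}) (m : nat) : R :=
  (m%:R^-1 * \sum_(i <- take m (sort_by h S)) (h i)^-1)^-1
    * (1 + sigma ^+ 2 / (eps * m%:R)).

(* t_k(S) *)
Definition level_cost (d : nat) (h : V -> R) (sigma eps : R)
    (w : {set V} -> R) (es : seq {set V}) (k : nat) (S : {set V}) : R :=
  d%:R * inv_wbar w es k
    + minimum [set m | (1 <= m <= #|S|)%N] (comp_cost h sigma eps S).

(* S is a set that the preprocessing procedure may return, found at step k. *)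
Definition preprocessing_output (d : nat) (h : V -> R) (sigma eps : R)
    (F : {set {set V}}) (w : {set V} -> R) (es : seq {set V})
    (k : nat) (S : {set V}) : Prop :=
  [/\ (1 <= k <= #|V|)%N,
      S \in level F es k
    & forall k' S', (1 <= k' <= #|V|)%N -> S' \in level F es k' ->
        level_cost d h sigma eps w es k S
        <= level_cost d h sigma eps w es k' S'].

(* The workers of S start computing at time 0, and tau is the time at which
   m gradients have been collected, B i of them from worker i. Worker i
   finishes its l-th gradient at time l * h i; every gradient finished before
   tau is counted, and the last counted one is finished at tau (gradients
   finished exactly at tau may be left out, to get the total m). *)
Definition batch_collected (h : V -> R) (S : {set V}) (m : nat)
    (B : V -> nat) (tau : R) : Prop :=
  [/\ (\sum_(i in S) B i)%N = m,
      forall i, i \in S -> (B i)%:R * h i <= tau <= (B i).+1%:R * h i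
    & exists2 i, i \in S & (0 < B i)%N /\ tau = (B i)%:R * h i].

(* Edge-disjoint trees (N j, F j) in the multigraph where {u, v} is repeated
   mult u v times; the edge e of the j-th tree is the copy number copy j e
   of e. *)
Definition steiner_packing (mult : V -> V -> nat) (S : {set V}) (p : nat)
    (N : 'I_p -> {set V}) (F : 'I_p -> {set {set V}})
    (copy : 'I_p -> {set V} -> nat) : Prop :=
  [/\ forall j, is_tree (N j) (F j) /\ S \subset N j,
      forall j u v, adj (F j) u v -> (copy j [set u; v]%SET < mult u v)%N
    & forall j j' e, j != j' -> e \in F j -> e \in F j' ->
        copy j e != copy j' e].

(* Streaming of s coordinates along the tree (N, F) with pivot v, when one
   coordinate takes q seconds on each tree edge. Each node sends its
   coordinates in order over the edge towards (resp. away from) v, starting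
   with each of them as soon as it is available at the node and the previous
   one has been sent. Times are counted from the beginning of the AllReduce. *)

(* time at which coordinate c has reached u from all its children *)
Definition aggregated_at (F : {set {set V}}) (v : V) (red : V -> nat -> R)
    (u : V) (c : nat) : R :=
  \big[Num.max/0]_(u' : V | towards F v u' u) red u' c.

(* red u c: time at which u has finished sending coordinate c towards v *)
Definition reduce_times (q : R) (N : {set V}) (F : {set {set V}}) (v : V)
    (s : nat) (red : V -> nat -> R) : Prop :=
  forall u c, u \in N -> u != v -> (c < s)%N ->
    red u c = Num.max (aggregated_at F v red u c)
                      (if c is c'.+1 then red u c' else 0) + q.

(* bc u c: time at which u has coordinate c of the sum; the broadcast starts
   once the whole block has been summed at v *)
Definition bcast_times (q : R) (F : {set {set V}}) (v : V) (s : nat)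
    (red bc : V -> nat -> R) : Prop :=
  (forall c, (c < s)%N ->
    bc v c = \big[Num.max/0]_(c' < s) aggregated_at F v red v c') /\
  (forall u w c, towards F v u w -> (c < s)%N ->
    bc u c = Num.max (bc w c) (if c is c'.+1 then bc u c' else 0) + q).

(* tau is the time that the AllReduce for S takes: the blocks, of
   ceil(d / p) coordinates, are processed in parallel. *)
Definition allreduce_time (q : R) (d : nat) (S : {set V}) (v : V) (p : nat)
    (N : 'I_p -> {set V}) (F : 'I_p -> {set {set V}}) (tau : R) : Prop :=
  if (#|S| <= 1)%N then tau = 0 else
  let s := ceiln (d%:R / p%:R : R) in
  exists red bc : 'I_p -> V -> nat -> R,
    (forall j, reduce_times q (N j) (F j) v s (red j) /\
               bcast_times q (F j) v s (red j) (bc j)) /\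
    tau = \big[Num.max/0]_(j < p) \big[Num.max/0]_(u in S)
            \big[Num.max/0]_(c < s) bc j u c.

End Network.

Section Optimization.
Variable R : realType.

(* The norm of the library on row vectors is the sup norm. *)
Definition enorm (d : nat) (x : 'rV[R]_d) : R :=
  Num.sqrt (\sum_i x 0 i ^+ 2).

Definition grad (d : nat) (f : 'rV[R]_d -> R) (x : 'rV[R]_d) : 'rV[R]_d :=
  \row_i 'D_(delta_mx 0 i) f x.

Definition smooth (d : nat) (L : R) (f : 'rV[R]_d -> R) : Prop :=
  (forall x, differentiable f x) /\
  forall x y, enorm (grad f x - grad f y) <= L * enorm (x - y).

(* g x s is the stochastic gradient at x for the sample s, of law D. It is
   jointly measurable, R^d being seen as d.-tuple R to get its Borel
   sigma-algebra. *)
Definition stochastic_gradient (d : nat) (dXi : measure_display)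
    (Xi : measurableType dXi) (D : probability Xi R)
    (f : 'rV[R]_d -> R) (sigma : R) (g : 'rV[R]_d -> Xi -> 'rV[R]_d) : Prop :=
  [/\ forall i, measurable_fun [set: d.-tuple R * Xi]
        (fun a : d.-tuple R * Xi => g (\row_l tnth a.1 l) a.2 0 i),
      forall x i, D.-integrable [set: Xi] (fun s => (g x s 0%R i)%:E),
      forall x i, ('E_D[fun s => g x s 0%R i] = (grad f x 0%R i)%:E)%E
    & forall x, ('E_D[fun s => (enorm (g x s - grad f x) ^+ 2)%R]
                  <= (sigma ^+ 2)%:E)%E].

Definition mutually_independent (dT : measure_display) (T : measurableType dT)
    (P : probability T R) (J : eqType) (A : J -> set (set T)) : Prop :=
  forall (s : seq J) (E : J -> set T), uniq s ->
    (forall j, j \in s -> A j (E j)) ->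
    (P (\bigcap_(j in [set` s]) E j) = \prod_(j <- s) P (E j))%E.

(* The samples xi k i j are i.i.d. of law D, and the index I is uniform on
   {0, ..., M-1} and independent of them. The index set of the family adds
   None, for I, to the triples (k, i, j). *)
Definition samples_and_index (V : eqType)
    (dT : measure_display) (T : measurableType dT) (P : probability T R)
    (dXi : measure_display) (Xi : measurableType dXi) (D : probability Xi R)
    (xi : nat -> V -> nat -> {mfun T >-> Xi})
    (M : nat) (I : {mfun T >-> nat}) : Prop :=
  [/\ forall k i j (A : set Xi), measurable A -> P (xi k i j @^-1` A) = D A,
      forall k, (k < M)%N -> P (I @^-1` [set k]) = (M%:R^-1)%:E
    & mutually_independent P
        (fun a : option (nat * V * nat) =>
           match a with
           | None => preimage_set_system [set: T] I measurable
           | Some (k, i, j) =>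
               preimage_set_system [set: T] (xi k i j) measurable
           end)].

(* Iterates of Grace SGD run by the workers of S, B k i being the local batch
   size of worker i in iteration k. *)
Fixpoint grace_iter (V : finType) (T Xi : Type) (d : nat)
    (g : 'rV[R]_d -> Xi -> 'rV[R]_d) (gamma : R) (x0 : 'rV[R]_d) (S : {set V})
    (B : nat -> V -> nat) (xi : nat -> V -> nat -> T -> Xi)
    (k : nat) (t : T) : 'rV[R]_d :=
  if k is k'.+1 then
    let x := grace_iter g gamma x0 S B xi k' t in
    x - (gamma / (\sum_(i in S) B k' i)%:R)
          *: \sum_(i in S) \sum_(j < B k' i) g x (xi k' i j t)
  else x0.

(* Duration of the first m iterations, tcomp k being the time of step (i) in
   iteration k and tcomm the time of one AllReduce. *)
Definition grace_time (tcomp : nat -> R) (tcomm : R) (m : nat) : R :=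
  \sum_(k < m) (tcomp k + tcomm).

(* E[|| grad f (xbar) ||^2] <= eps *)
Definition stationary (d : nat) (dT : measure_display) (T : measurableType dT)
    (P : probability T R) (f : 'rV[R]_d -> R) (eps : R)
    (xbar : T -> 'rV[R]_d) : Prop :=
  ('E_P[fun t => (enorm (grad f (xbar t)) ^+ 2)%R] <= eps%:E)%E.

End Optimization.

(* Main.v *)
Require Import Defs.
From HB Require Import structures.
From mathcomp Require Import all_boot all_order all_algebra.
From mathcomp Require Import all_classical all_reals all_analysis.
From mathcomp Require Import measurable_realfun.
From mathcomp Require Import zify ring lra.

Set Implicit Arguments.
Unset Strict Implicit.
Unset Printing Implicit Defensive.

Import Order.TTheory GRing.Theory Num.Theory.
Import numFieldNormedType.Exports.

Local Open Scope classical_set_scope.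
Local Open Scope ring_scope.

(* Time.  With equal speeds the cost of a component S at level k is
   d / w_k + h0 + h0 sigma^2 / (|S| eps), so the returned set attains the
   minimum of the bound up to the additive h0.  A component has no cut below
   the smallest edge weight w_k left in the Gomory-Hu tree, hence the AllReduce
   takes O(d / w_k): a coordinate leaves each node of a packed tree at most
   #|V| steps after its rank in the stream, and #|V| p <= d.

   Stationarity.  The gap f - fstar after a step is bounded, by the descent
   lemma, by a quadratic in the accumulated gradient noise.  This bound is
   nonnegative even for a partial sum of the noise, so the samples can be
   integrated out one at a time by Tonelli's theorem, without any integrability
   to check along the iterations.  Each new sample adds at most
   L gamma^2 sigma^2 / (2 m^2) to its expectation. *)

(** * Trees *)

Section Trees.
Variable V : finType.
Implicit Types (F : {set {set V}}) (N : {set V}) (u v w r : V) (p : seq V).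

Lemma adj_sym F : symmetric (adj F).
Proof. by move=> u v; rewrite /adj /= eq_sym finset.setUC. Qed.

Lemma connect_adj_sym F : connect_sym (adj F).
Proof. exact: (sym_connect_sym (@adj_sym F)). Qed.

Lemma set2_eq u v x y : u != v ->
  ([set u; v]%SET == [set x; y]%SET) =
  ((u == x) && (v == y)) || ((u == y) && (v == x)).
Proof.
move=> uv; apply/eqP/idP => [E|/orP[/andP[/eqP-> /eqP->]|/andP[/eqP-> /eqP->]]] //; last first.
  by rewrite finset.setUC.
have : u \in [set x; y]%SET by rewrite -E !inE eqxx.
have : v \in [set x; y]%SET by rewrite -E !inE eqxx orbT.
rewrite !inE => /orP[]/eqP Ev /orP[]/eqP Eu; subst; rewrite ?eqxx ?orbT //.
  by rewrite eqxx in uv.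
by rewrite eqxx in uv.
Qed.

(** The removed edge contains u, so a walk using it would visit u. *)
Lemma path_avoid F u w x p : path (adj F) x p -> u \notin x :: p ->
  path (adj (F :\ [set u; w])%SET) x p.
Proof.
elim: p x => //= y p IH x /andP[/andP[xy xyF] yp].
rewrite !inE !negb_or => /and3P[ux uy up].
rewrite IH ?inE ?negb_or ?uy // andbT /adj /= xy !inE xyF andbT set2_eq //.
by rewrite [x == u]eq_sym [y == u]eq_sym (negbTE ux) (negbTE uy) andbF.
Qed.

Lemma connect_avoid F u w x p v : path (adj F) x p -> u \notin x :: p ->
  last x p = v -> connect (adj (F :\ [set u; w])%SET) x v.
Proof.
by move=> xp up <-; apply/connectP; exists p => //; apply: path_avoid.
Qed.

(** A simple path from u to w without the edge {u, w} has at least two edges; that edge would close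
    it into a cycle on three or more nodes, against the size bound in [is_tree]. *)
Lemma bridge N F u w : is_tree N F -> adj F u w ->
  ~~ connect (adj (F :\ [set u; w])%SET) u w.
Proof.
move=> [_ _ _ acyc] uw; apply/negP => /connectP[p0 p0P wE].
case/shortenP: p0P wE => p pP up _ wE.
have pF : path (adj F) u p.
  apply: sub_path pP => x y; rewrite /adj /= => /andP[-> /=].
  by rewrite !inE => /andP[].
have /acyc : ucycle (adj F) (u :: p).
  by apply/andP; split=> //; rewrite /cycle rcons_path pF -wE adj_sym.
case: p {pF} pP up wE => [|x [|y p]] //=.
  by move=> _ _ E; move: uw; rewrite /adj /= E eqxx.
by move=> /andP[/andP[_]]; rewrite !inE => /andP[/eqP nE _] _ _ E; case: nE; rewrite E.
Qed.

Lemma uniq_connect F u v : connect (adj F) u v ->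
  exists p, [/\ path (adj F) u p, uniq (u :: p) & last u p = v].
Proof.
by move=> /connectP[p0 p0P ->]; case/shortenP: p0P => p ? ? _; exists p.
Qed.

Lemma towards_uniq N F v u' u p : is_tree N F -> towards F v u' u ->
  path (adj F) u p -> uniq (u :: p) -> last u p = v ->
  path (adj F) u' (u :: p) /\ uniq (u' :: u :: p).
Proof.
move=> tF /andP[u'u uv] up uniqp lp; split; first by rewrite /= u'u.
rewrite cons_uniq uniqp andbT; apply/negP => u'p.
have u'neu : u' != u by case/andP: u'u.
move: u'p; rewrite inE (negbTE u'neu) /= => u'p.
case/splitPr: u'p up uniqp lp => p1 p2.
rewrite cat_path /= => /and3P[_ _ u'p2]; rewrite mem_cat negb_or last_cat /= => uniqp lp.
have uN : u \notin u' :: p2 by case/andP: uniqp => /andP[].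
have u'v : connect (adj (F :\ [set u'; u])%SET) u' v.
  by rewrite finset.setUC; apply: connect_avoid u'p2 uN lp.
have := bridge tF u'u; rewrite (connect_trans u'v) //.
by rewrite connect_adj_sym.
Qed.

Lemma towards_head F v u w p :
  path (adj F) u (w :: p) -> uniq (u :: w :: p) -> last w p = v ->
  towards F v u w.
Proof.
move=> /= /andP[uw wp] /andP[uwp _] lp; rewrite /towards uw /=.
exact: connect_avoid wp uwp lp.
Qed.

(** If w' differs from w, the path from u to v through w avoids the edge {u, w'}. Since w' also
    reaches v without it, u and w' would stay linked, against [bridge]. *)
Lemma towards_inj N F v u w w' : is_tree N F ->
  towards F v u w -> towards F v u w' -> w = w'.
Proof.
move=> tF uw /andP[uw' w'v]; case/andP: (uw) => uwF wv.
have [p [wp uniqp lp]] : exists p, [/\ path (adj F) w p, uniq (w :: p) & last w p = v].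
  apply: uniq_connect; apply: connect_sub wv => x y /andP[xy].
  by rewrite !inE => /andP[_ xyF]; apply: connect1; rewrite /adj /= xy.
have [/= pF /andP[up _]] := towards_uniq tF uw wp uniqp lp.
apply/eqP/negPn/negP => ww'.
have uneqw : u != w by case/andP: uwF.
have uv : connect (adj (F :\ [set u; w'])%SET) u v.
  rewrite -lp -[last w p]/(last u (w :: p)); apply/connectP; exists (w :: p) => //=.
  rewrite path_avoid // andbT /adj /= uneqw !inE; case/andP: uwF => _ ->.
  by rewrite andbT set2_eq // eqxx (negbTE ww') [w == u]eq_sym (negbTE uneqw) !andbF.
have := bridge tF uw'; rewrite (connect_trans uv) //.
by rewrite connect_adj_sym.
Qed.

(** Root the tree at some r: sending each other node to the edge to its parent is a bijection onto
    the edges. *)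
Lemma card_tree F : is_tree [set: V]%SET F -> #|F| = #|V|.-1.
Proof.
move=> tF; have [/set0Pn[r _] F2 conn _] := tF.
pose par u := odflt u [pick w | towards F r u w].
have parP u : u != r -> towards F r u (par u).
  move=> ur; rewrite /par; case: pickP => //= nw.
  have [[|w p] [up uniqp lp]] := uniq_connect (conn u r (finset.in_setT _) (finset.in_setT _)).
    by rewrite -lp eqxx in ur.
  by have := nw w; rewrite /= (towards_head up uniqp lp).
have -> : F = [set [set u; par u]%SET | u in [set~ r]]%SET.
  apply/setP => e; apply/idP/imsetP => [eF|[u]]; last first.
    by rewrite !inE => /parP /andP[/andP[_ ?] _] ->.
  have /eqP/cards2P[a [b0 [ab eE]]] := proj1 (F2 _ eF).
  have abF : adj F a b0 by rewrite /adj /= ab -eE.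
  suff [u [w [uw eE']]] : exists u w, towards F r u w /\ e = [set u; w]%SET.
    have ur : u != r.
      apply/eqP => ur; case/andP: uw => uw; rewrite connect_adj_sym -ur.
      by rewrite (negbTE (bridge tF uw)).
    exists u; first by rewrite !inE.
    by rewrite eE'; congr [set _; _]%SET; apply: towards_inj tF uw (parP _ ur).
  (* The path from a to r orients the edge: a points to b0 if the path visits b0, and b0 points to a
     otherwise. *)
  have [p [ap uniqp lp]] := uniq_connect (conn a r (finset.in_setT _) (finset.in_setT _)).
  have [bp|bp] := boolP (b0 \in a :: p).
    exists a, b0; split=> //; rewrite /towards abF /=.
    move: bp; rewrite inE [b0 == a]eq_sym (negbTE ab) /= => bp.
    case/splitPr: bp ap uniqp lp => p1 p2.
    rewrite cat_path /= mem_cat negb_or last_cat => /and3P[_ _ bp2] /andP[/andP[_ ap2] _] /= lp.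
    exact: connect_avoid bp2 ap2 lp.
  exists b0, a; split; last by rewrite eE finset.setUC.
  rewrite /towards adj_sym abF /=.
  exact: connect_avoid ap bp lp.
rewrite card_in_imset; first by rewrite cardsC1.
move=> u u'; rewrite !inE => ur u'r /eqP.
have /andP[uE _] := parP _ ur.
rewrite set2_eq; last by case/andP: uE.
case/orP => [/andP[/eqP //]|/andP[/eqP E1 /eqP E2]].
(* Here u and u' are each other's parent, so both stay linked to r without their common edge,
   against [bridge]. *)
have /andP[uw c1] := parP _ ur; have /andP[_ c2] := parP _ u'r.
have := bridge tF uw; rewrite connect_adj_sym (connect_trans c1) //.
by move: c2; rewrite connect_adj_sym E2 -E1 finset.setUC.
Qed.

End Trees.

(** * Streaming time of the AllReduce *)

Section Streaming.
Variables (R : realType) (V : finType) (q : R) (N : {set V}) (F : {set {set V}}).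
Variables (v : V) (s n : nat).
Hypotheses (q0 : 0 <= q) (tF : is_tree N F).
Hypothesis uniq_size : forall t : seq V, uniq t -> (size t <= n)%N.

(** One step of the recursions in [reduce_times] and [bcast_times]: a is when the coordinate
    arrives, b when the previous one has left. *)
Lemma ler_streaming (a b x : R) (m k : nat) :
  a <= x + q * m%:R -> b <= x + q * m%:R -> (m < k)%N ->
  Num.max a b + q <= x + q * k%:R.
Proof.
move=> am bm mk; have mab : Num.max a b <= x + q * m%:R by rewrite ge_max am.
have : q * m.+1%:R <= q * k%:R by rewrite ler_wpM2l // ler_nat.
by rewrite -natr1 mulrDr mulr1; lra.
Qed.

Lemma adj_node u w : adj F u w -> (u \in N) && (w \in N).
Proof.
have [_ F2 _ _] := tF; move=> /andP[_ /F2[_ /fintype.subsetP uwN]].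
by rewrite !uwN // !inE eqxx ?orbT.
Qed.

(* p is the path from u to the pivot, so that the coordinate has crossed at
   most n - size p - 1 edges when it is available at u. *)
Lemma aggregated_le (red : V -> nat -> R) u p c :
  reduce_times q N F v s red -> (c < s)%N ->
  path (adj F) u p -> uniq (u :: p) -> last u p = v ->
  aggregated_at F v red u c <= q * (c + (n - size p).-1)%:R.
Proof.
(* The outer induction moves away from the pivot, where the path is longer and n - size p smaller;
   the inner one is on the rank c in the stream. *)
move=> hred; have [k] := ubnP (n - size p)%N.
elim: k u p c => // k IH u p c hk cs up uniqp lp.
apply: bigmax_le => [|u' u'u]; first by rewrite mulr_ge0.
have [u'p uniqp'] := towards_uniq tF u'u up uniqp lp.
have sp : ((size p).+1 < n)%N := uniq_size uniqp'.
have u'v : u' != v.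
  apply/eqP => u'v; move: uniqp'; rewrite cons_uniq => /andP[+ _].
  by rewrite u'v -lp mem_last.
have /andP[u'N _] := adj_node (proj1 (andP u'u)).
have agg c' : (c' < s)%N ->
    aggregated_at F v red u' c' <= q * (c' + (n - (size p).+1).-1)%:R.
  by move=> c's; apply: (IH u' (u :: p)) => //=; lia.
elim: c cs => [|c IHc] cs; rewrite hred // -[leRHS]add0r.
  apply: (@ler_streaming _ _ _ (0 + (n - (size p).+1).-1)%N); rewrite ?add0r.
  - exact: agg.
  - by rewrite mulr_ge0.
  - lia.
apply: (@ler_streaming _ _ _ (c + (n - size p).-1)%N); rewrite ?add0r.
- apply: le_trans (agg _ cs) _; rewrite ler_wpM2l // ler_nat; lia.
- by apply: IHc; lia.
- lia.
Qed.

(** The pivot has the whole block by time q (s + n), from [aggregated_le] with the empty path.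
    Coordinate c then crosses the size p edges of the path behind c earlier ones. *)
Lemma bcast_le (red bc : V -> nat -> R) u p c :
  reduce_times q N F v s red -> bcast_times q F v s red bc -> (c < s)%N ->
  path (adj F) u p -> uniq (u :: p) -> last u p = v ->
  bc u c <= q * (s + n)%:R + q * (c + size p)%:R.
Proof.
move=> hred [bcv bcu]; elim: p u c => [|w p IH] u c cs up uniqp lp.
  rewrite -[u]/(last u [::]) lp bcv // -[leLHS]addr0 lerD ?mulr_ge0 //.
  apply: bigmax_le => [|[c' c's] _]; first by rewrite mulr_ge0.
  apply: le_trans (@aggregated_le red v [::] c' hred c's _ _ _) _ => //=.
  rewrite ler_wpM2l // ler_nat; lia.
have uw := towards_head up uniqp lp.
have IHw c' : (c' < s)%N ->
    bc w c' <= q * (s + n)%:R + q * (c' + size p)%:R.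
  by move=> c's; apply: IH => //; [case/andP: up|case/andP: uniqp].
elim: c cs => [|c IHc] cs; rewrite (bcu _ _ _ uw) //.
  apply: (@ler_streaming _ _ _ (0 + size p)%N) => //.
  - exact: IHw.
  - by rewrite addr_ge0 ?mulr_ge0.
apply: (@ler_streaming _ _ _ (c.+1 + size p)%N).
- exact: IHw.
- by apply: le_trans (IHc (ltnW cs)) _ => /=; rewrite addnS addSn.
- by rewrite /=; lia.
Qed.

End Streaming.

Lemma ceiln_le (R : realType) (x : R) : 0 <= x -> (ceiln x)%:R <= x + 1.
Proof.
move=> x0; rewrite /ceiln natr_absz ger0_norm ?ceil_ge0; last first.
  by rewrite (lt_le_trans _ x0) // ltrN10.
by have := ceilB1_lt x; rewrite intrB; lra.
Qed.

Lemma ceiln_ge (R : realType) (x : R) : 0 <= x -> x <= (ceiln x)%:R.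
Proof.
move=> x0; rewrite /ceiln natr_absz ger0_norm ?ceil_ge0 ?ceil_ge //.
by rewrite (lt_le_trans _ x0) // ltrN10.
Qed.

(** Reduction and broadcast take at most q (s + n) each, where s is d / p rounded up. From 1 <= n <=
    d / p one gets s + n <= 3 d / p, whence the factor 6. *)
Lemma allreduce_time_le (R : realType) (V : finType) (q : R) (d : nat)
    (S : {set V}) (v : V) (n p : nat) (N : 'I_p -> {set V})
    (F : 'I_p -> {set {set V}}) (tau : R) :
  (forall t : seq V, uniq t -> (size t <= n)%N) ->
  0 <= q -> (forall j, is_tree (N j) (F j) /\ S \subset N j) -> v \in S ->
  (0 < p)%N -> (n * p <= d)%N -> (1 < #|S|)%N ->
  allreduce_time q d S v N F tau -> tau <= 6%:R * q * (d%:R / p%:R).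
Proof.
move=> uniq_size q0 tNF vS p0 npd S1; rewrite /allreduce_time leqNgt S1 /=.
set s := ceiln _ => -[red [bc [hrb ->]]].
have p0R : 0 < p%:R :> R by rewrite ltr0n.
have n0 : (0 < n)%N := uniq_size [:: v] isT.
have dp1 : n%:R <= d%:R / p%:R :> R by rewrite ler_pdivlMr // -natrM ler_nat.
have n1 : 1 <= n%:R :> R by rewrite ler1n.
have ub0 : 0 <= 6%:R * q * (d%:R / p%:R) by rewrite mulr_ge0 ?mulr_ge0 ?divr_ge0.
apply: bigmax_le => // j _; apply: bigmax_le => // u uS.
apply: bigmax_le => // -[c cs] _ /=.
have [hred hbc] := hrb j; have [tF SN] := tNF j.
have [_ _ conn _] := tF.
have [t [ut uniqt lt]] := uniq_connect (conn _ _ (fintype.subsetP SN _ uS) (fintype.subsetP SN _ vS)).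
apply: le_trans (bcast_le q0 tF uniq_size hred hbc cs ut uniqt lt) _.
have st : (size t < n)%N := uniq_size _ uniqt.
rewrite -mulrDr -natrD [6%:R * q]mulrC -mulrA ler_wpM2l //.
apply: (@le_trans _ _ (2 * (s%:R + n%:R))).
  rewrite -natrD -natrM ler_nat; lia.
have : s%:R <= d%:R / p%:R + 1 :> R by apply: ceiln_le; rewrite divr_ge0.
lra.
Qed.

(** * Gomory-Hu trees and the preprocessing *)

Lemma connect_crossing (V : finType) (e : rel V) (A : {pred V}) (x y : V) :
  connect e x y -> x \in A -> y \notin A ->
  exists x' y', [/\ e x' y', x' \in A & y' \notin A].
Proof.
case/connectP => p; elim: p x => [|z p IH] x /=; first by move=> _ -> ->.
move=> /andP[xz zp] lp xA yA; have [zA|zA] := boolP (z \in A).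
  exact: IH zp lp zA yA.
by exists x, z.
Qed.

Lemma lb_le_minimum (R : realType) (I : Type) (A : set I) (F : I -> R) (x : R) :
  A !=set0 -> (forall i, A i -> x <= F i) -> x <= minimum A F.
Proof.
move=> [i Ai] xF; apply: lb_le_inf; first by exists (F i), i.
by move=> _ [j Aj <-]; exact: xF.
Qed.

(** [minimum] is an [inf], so the lower bound x is supplied to make it a genuine infimum. *)
Lemma minimum_le (R : realType) (I : Type) (A : set I) (F : I -> R) (x : R) i :
  (forall j, A j -> x <= F j) -> A i -> minimum A F <= F i.
Proof.
move=> xF Ai; apply: ge_inf; last by exists i.
by exists x => _ [j Aj <-]; exact: xF.
Qed.

Section Cuts.
Variables (R : realType) (V : finType) (b : V -> V -> R).
Hypothesis hb : network b.

Lemma cut_gt0 (U : {set V}) i j : i \in U -> j \notin U -> 0 < Defs.cut b U.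
Proof.
case: hb => b0 _ _ conn iU jU.
have [i' [j' [/= bij i'U j'U]]] := connect_crossing (conn i j) iU jU.
rewrite /Defs.cut (bigD1 i') //= ltr_wpDr ?sumr_ge0 //; first by move=> *; rewrite sumr_ge0.
rewrite (bigD1 j') ?inE //= ltr_wpDr ?sumr_ge0 //.
Qed.

Variables (F : {set {set V}}) (w : {set V} -> R) (es : seq {set V}).
Hypotheses (hT : gomory_hu_tree b F w) (hes : sorted_edges F w es).

Lemma gomory_hu_weight_gt0 e : e \in F -> 0 < w e.
Proof.
case: hT => tF wF eF; have [_ F2 _ _] := tF.
have /eqP/cards2P[i [j [ij eE]]] := proj1 (F2 _ eF).
have aij : adj F i j by rewrite /adj /= ij -eE.
have [_] := wF i j aij; rewrite eE => ->.
apply: (@cut_gt0 _ i j); rewrite inE; first exact: connect0.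
exact: bridge tF aij.
Qed.

Lemma gomory_hu_weight_le u v (U : {set V}) :
  adj F u v -> u \in U -> v \notin U -> w [set u; v]%SET <= Defs.cut b U.
Proof.
by case: hT => _ wF uv uU vU; have [wle ->] := wF _ _ uv; exact: wle.
Qed.

Lemma size_sorted_edges : size es = #|V|.-1.
Proof.
case: hes => /perm_size -> _; rewrite -cardE.
by apply: card_tree; case: hT.
Qed.

Lemma mem_sorted_edges : es =i F.
Proof. by case: hes => /perm_mem esF _ e; rewrite esF mem_enum. Qed.

Lemma inv_wbar_ge0 k : (0 < k)%N -> 0 <= inv_wbar w es k.
Proof.
move=> k0; rewrite /inv_wbar; case: ifP => // kn.
rewrite invr_ge0 ltW // gomory_hu_weight_gt0 // -mem_sorted_edges mem_nth //.
by rewrite size_sorted_edges; lia.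
Qed.

(** S is connected by tree edges kept at level k, so any cut separating S is crossed by one of them.
    Its weight is at most the cut by the Gomory-Hu property and at least the k-th weight by the
    sorting. Two points in S force such an edge to exist, so k < #|V| and [inv_wbar] is a true
    inverse. *)
Lemma level_mincut k (S : {set V}) : (0 < k)%N -> (1 < #|S|)%N ->
  S \in level F es k ->
  exists2 x, 0 < x <= steiner_mincut b S & inv_wbar w es k = x^-1.
Proof.
move=> k0 S1 /imsetP[u0 _ SE].
pose F' := [set e in F | e \notin take k.-1 es]%SET; rewrite -/F' in SE.
have SF' x y : x \in S -> y \in S -> connect (adj F') x y.
  rewrite SE !inE connect_adj_sym => xu uy; exact: connect_trans xu uy.
have wle e : e \in F' -> (k.-1 < size es)%N /\ w (nth finset.set0 es k.-1) <= w e.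
  rewrite inE -mem_sorted_edges => /andP[ees].
  move=> etake; have ki : (k.-1 <= index e es)%N.
    rewrite leqNgt; apply: contra etake => ik.
    rewrite -(nth_index finset.set0 ees) -(nth_take _ ik) mem_nth //.
    by rewrite size_take; case: ifP => //; rewrite index_mem.
  have es_i : (index e es < size es)%N by rewrite index_mem.
  have ks : (k.-1 < size es)%N by lia.
  split=> //; rewrite -[in leRHS](nth_index finset.set0 ees).
  have [_ ess] := hes.
  apply: (sorted_leq_nth _ _ _ ess) => //.
  by move=> ? ? ?; exact: le_trans.
have crossing (U : {set V}) x y : x \in S -> y \in S -> x \in U -> y \notin U ->
    exists2 e, e \in F' & w e <= Defs.cut b U.
  move=> xS yS xU yU.
  have [x' [y' [/andP[ne eF'] x'U y'U]]] := connect_crossing (SF' _ _ xS yS) xU yU.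
  exists [set x'; y']%SET => //; apply: gomory_hu_weight_le => //.
  by rewrite /adj /= ne; move: eF'; rewrite inE => /andP[].
have /card_gt1P[x [y [xS yS xy]]] := S1.
have [||||e eF' _] := crossing [set x]%SET x y; rewrite ?inE // 1?eq_sym //.
have [ks _] := wle _ eF'; rewrite size_sorted_edges in ks.
exists (w (nth finset.set0 es k.-1)); last first.
  by rewrite /inv_wbar ifT //; lia.
apply/andP; split.
  by rewrite gomory_hu_weight_gt0 // -mem_sorted_edges mem_nth // size_sorted_edges.
apply: lb_le_minimum => [|U [/set0Pn[x1 +] /set0Pn[y1 +]]].
  exists [set x]%SET; split; apply/set0Pn; [exists x|exists y].
    by rewrite !inE eqxx.
  by rewrite !inE eq_sym xy.
rewrite !inE => /andP[x1U x1S] /andP[y1U y1S].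
have [e' e'F' we'] := crossing U x1 y1 x1S y1S x1U y1U.
exact: le_trans (proj2 (wle _ e'F')) we'.
Qed.

Lemma level_neq0 k (S : {set V}) : S \in level F es k -> (0 < #|S|)%N.
Proof.
by case/imsetP => u _ ->; apply/card_gt0P; exists u; rewrite inE connect0.
Qed.

End Cuts.

(** * Computation times and level costs for workers of equal speed *)

Section ConstantSpeed.
Variables (R : realType) (V : finType) (h : V -> R) (h0 sigma eps : R).
Hypotheses (h00 : 0 < h0) (hh : forall i, h i = h0) (eps0 : 0 < eps).

(** When worker i delivers the last gradient, its B i-th, every worker of S has delivered at least B
    i - 1. Leaving out that last gradient, #|S| (B i - 1) <= m - 1. *)
Lemma batch_time_le (S : {set V}) m (B : V -> nat) tau :
  batch_collected h S m B tau -> tau <= h0 * (m.-1%:R / #|S|%:R + 1).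
Proof.
clear eps0 => -[] Bm htau [i iS [Bi0 tauE]].
have BiBj j : j \in S -> ((B i).-1 <= B j)%N.
  move=> /htau /andP[_]; rewrite tauE !hh ler_pM2r // ler_nat; lia.
have S0 : (0 < #|S|)%N by apply/card_gt0P; exists i.
have : (#|S| * (B i).-1 <= m.-1)%N.
  have : (\sum_(j in S) (B i).-1 < m)%N.
    rewrite -Bm (bigD1 i) //= [in leqRHS](bigD1 i) //= -addSn leq_add //; first lia.
    by apply: leq_sum => j /andP[jS _]; exact: BiBj.
  by rewrite sum_nat_const; lia.
rewrite tauE hh mulrC ler_pM2l // -(ler_nat R) natrM => le1.
have S0R : 0 < #|S|%:R :> R by rewrite ltr0n.
have -> : (B i)%:R = (B i).-1%:R + 1 :> R by rewrite natr1 prednK.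
by rewrite lerD2r ler_pdivlMr // mulrC.
Qed.

Lemma batch_size_le x : 0 <= x -> (maxn (ceiln x) 1).-1%:R <= x :> R.
Proof.
move=> x0; have := ceiln_le x0; case: (ceiln x) => [|c] //.
by rewrite (maxn_idPl _) //= -natr1; lra.
Qed.

Lemma comp_cost_const (S : {set V}) m : (0 < m <= #|S|)%N ->
  comp_cost h sigma eps S m = h0 + h0 * (sigma ^+ 2 / (m%:R * eps)).
Proof.
move=> /andP[m0 mS]; rewrite /comp_cost.
have szm : size (take m (sort_by h S)) = m.
  by rewrite size_takel // size_sort -cardE.
under eq_bigr do rewrite hh.
rewrite big_const_seq count_predT szm iter_addr_0 -[h0^-1 *+ m]mulr_natl mulKf.
  by rewrite invrK mulrDr mulr1 [eps * _]mulrC.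
by rewrite pnatr_eq0 -lt0n.
Qed.

(** With equal speeds [comp_cost] is nonincreasing in m, so its minimum is at m = #|S|. *)
Lemma level_cost_const d (w : {set V} -> R) es k (S : {set V}) : (0 < #|S|)%N ->
  level_cost d h sigma eps w es k S =
  d%:R * inv_wbar w es k + h0 + h0 * sigma ^+ 2 / (#|S|%:R * eps).
Proof.
move=> S0; rewrite /level_cost -addrA -mulrA; congr (_ + _).
have S1 : (0 < #|S| <= #|S|)%N by rewrite S0 /=.
have ge m : (0 < m <= #|S|)%N ->
    h0 + h0 * (sigma ^+ 2 / (#|S|%:R * eps)) <= comp_cost h sigma eps S m.
  move=> mS; rewrite comp_cost_const // lerD2l ler_pM2l //.
  case/andP: mS => m0 mS; rewrite ler_wpM2l ?sqr_ge0 // lef_pV2 ?posrE ?mulr_gt0 ?ltr0n //.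
  by rewrite ler_pM2r // ler_nat.
apply: le_anti; rewrite -{1}(comp_cost_const S1) (minimum_le ge) //=.
by apply: lb_le_minimum; first by exists #|S|.
Qed.

Lemma level_cost_le (b : V -> V -> R) d (F : {set {set V}}) w es kstar S :
  network b -> gomory_hu_tree b F w -> sorted_edges F w es -> (0 < #|V|)%N ->
  preprocessing_output d h sigma eps F w es kstar S ->
  level_cost d h sigma eps w es kstar S <=
  minimum [set k : nat | (1 <= k <= #|V|)%N] (fun k => d%:R * inv_wbar w es k
        + minimum [set S' | S' \in level F es k]
            (fun S' : {set V} => h0 * sigma ^+ 2 / (#|S'|%:R * eps))) + h0.
Proof.
move=> hb hT hes /[dup] /card_gt0P[v _] V0 [k1 Sk opt].
rewrite -lerBlDr; apply: lb_le_minimum; first by exists 1%N.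
move=> k hk /=; rewrite -lerBlDl; apply: lb_le_minimum.
  by exists (component [set e in F | e \notin take k.-1 es]%SET v); rewrite /= imset_f.
move=> S' /= S'k; have := opt _ _ hk S'k.
rewrite [X in _ <= X]level_cost_const ?(level_neq0 S'k) //; lra.
Qed.

End ConstantSpeed.

Lemma grace_time_le (R : realType) (tcomp : nat -> R) (tcomm a : R) (m : nat) :
  (forall k, tcomp k + tcomm <= a) -> grace_time tcomp tcomm m <= m%:R * a.
Proof.
move=> ha; rewrite /grace_time mulr_natl.
rewrite -[X in _ *+ X]card_ord -sumr_const; exact: ler_sum.
Qed.

(** The batch accounts for the terms in h0. For the AllReduce, [level_mincut] and the packing bound
    turn q d / p into at most |c0| d / w_k. The absolute value keeps the constant positive for every
    real c0. *)
Lemma iteration_time_le (R : realType) (c0 : R) (V : finType) (n d : nat)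
    (h : V -> R) (h0 sigma eps : R) (b : V -> V -> R) (mult : V -> V -> nat)
    (q : nat) (F : {set {set V}}) (w : {set V} -> R) es k (S : {set V}) v p
    (NT : 'I_p -> {set V}) (FT : 'I_p -> {set {set V}}) copy B tau tcomm :
  (forall t : seq V, uniq t -> (size t <= n)%N) ->
  0 < h0 -> (forall i, h i = h0) -> 0 < eps ->
  network b -> (0 < q)%N ->
  gomory_hu_tree b F w -> sorted_edges F w es ->
  (0 < k)%N -> S \in level F es k -> v \in S ->
  ((1 < #|S|)%N ->
      [/\ steiner_packing mult S NT FT copy,
          q%:R * steiner_mincut b S <= c0 * p%:R
        & (n * p <= d)%N]) ->
  allreduce_time q%:R d S v NT FT tcomm ->
  batch_collected h S (maxn (ceiln (sigma ^+ 2 / eps)) 1) B tau ->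
  tau + tcomm <= (1 + 6%:R * `|c0|) * level_cost d h sigma eps w es k S.
Proof.
move=> uniq_size h00 hh eps0 hb q0 hT hes k0 Sk vS hp htc hB.
have S0 := level_neq0 Sk.
rewrite (level_cost_const _ h00 hh eps0) //.
have x0 : 0 <= sigma ^+ 2 / eps by rewrite divr_ge0 ?sqr_ge0 // ltW.
have y0 : 0 <= d%:R * inv_wbar w es k by rewrite mulr_ge0 // (inv_wbar_ge0 hb hT hes).
have S0R : 0 < #|S|%:R :> R by rewrite ltr0n.
have z0 : 0 <= h0 * sigma ^+ 2 / (#|S|%:R * eps).
  by apply: divr_ge0; rewrite mulr_ge0 ?sqr_ge0 ?ler0n ?(ltW h00) ?(ltW eps0).
have tauE : tau <= h0 + h0 * sigma ^+ 2 / (#|S|%:R * eps).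
  have := batch_time_le h00 hh hB => /le_trans; apply.
  rewrite mulrDr mulr1 addrC lerD2l -mulrA ler_wpM2l //; first exact: ltW.
  by rewrite [#|S|%:R * eps]mulrC invfM mulrA ler_wpM2r ?invr_ge0 // ?batch_size_le // ltW.
have tcE : tcomm <= 6%:R * `|c0| * (d%:R * inv_wbar w es k).
  have [S1|S1] := leqP #|S| 1.
    by move: htc; rewrite /allreduce_time S1 => ->; rewrite mulr_ge0 // mulr_ge0.
  have [[tNF _ _] qp np] := hp S1.
  have [x /andP[xp xle] ->] := level_mincut hb hT hes k0 S1 Sk.
  have q0R : 0 < q%:R :> R by rewrite ltr0n.
  have qx : q%:R * x <= `|c0| * p%:R.
    apply: le_trans (le_trans _ qp) _; first by rewrite ler_pM2l.
    by rewrite ler_wpM2r // ler_norm.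
  (* An empty packing would give q x <= 0 with q and x positive. *)
  have p0 : (0 < p)%N.
    rewrite lt0n; apply/negP => /eqP p0; move: qx.
    by rewrite p0 mulr0 leNgt mulr_gt0.
  have := allreduce_time_le uniq_size (ltW q0R) tNF vS p0 np S1 htc.
  move/le_trans; apply.
  rewrite -!mulrA ler_pM2l // mulrCA [leRHS]mulrCA ler_wpM2l //.
  by rewrite ler_pdivrMr ?ltr0n // mulrAC ler_pdivlMr.
have c00 : 0 <= 6%:R * `|c0| by rewrite mulr_ge0.
nra.
Qed.

(** * Descent lemma *)

Section Descent.
Variables (R : realType) (d : nat).
Implicit Types (f : 'rV[R]_d -> R) (x u v : 'rV[R]_d).

Definition dot u v : R := \sum_i u 0 i * v 0 i.

Lemma enorm_sq u : enorm u ^+ 2 = dot u u.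
Proof.
rewrite sqr_sqrtr; first by apply: eq_bigr => i _; rewrite expr2.
by apply: sumr_ge0 => i _; exact: sqr_ge0.
Qed.

Lemma dotC u v : dot u v = dot v u.
Proof. by apply: eq_bigr => i _; rewrite mulrC. Qed.

Lemma dotDl u u' v : dot (u + u') v = dot u v + dot u' v.
Proof. by rewrite -big_split; apply: eq_bigr => i _; rewrite mxE mulrDl. Qed.

Lemma dotZl a u v : dot (a *: u) v = a * dot u v.
Proof. by rewrite mulr_sumr; apply: eq_bigr => i _; rewrite mxE mulrA. Qed.

Lemma dotDr u v v' : dot u (v + v') = dot u v + dot u v'.
Proof. by rewrite dotC dotDl !(dotC u). Qed.

Lemma dotZr a u v : dot u (a *: v) = a * dot u v.
Proof. by rewrite dotC dotZl dotC. Qed.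

Lemma dot_ge0 u : 0 <= dot u u.
Proof. by rewrite -enorm_sq sqr_ge0. Qed.

(** Expand the square of u - c v: a form of Cauchy-Schwarz free of square roots. *)
Lemma dot_le (c : R) u v : 0 < c -> dot u u <= c ^+ 2 * dot v v ->
  dot u v <= c * dot v v.
Proof.
move=> c0 uv.
have := dot_ge0 (u - c *: v).
rewrite -scaleNr dotDl !dotDr !dotZl !dotZr [dot v u]dotC.
nra.
Qed.

Lemma derive_grad f x v : differentiable f x -> 'D_v f x = dot (grad f x) v.
Proof.
move=> fx; rewrite deriveE // {1}[v]row_sum_delta linear_sum /=.
apply: eq_bigr => i _; rewrite linearZ /= mulrC /grad mxE deriveE //.
Qed.

Lemma derive_line f x v (t : R) : differentiable f (x + t *: v) ->
  is_derive t 1 (fun s : R => f (x + s *: v)) (dot (grad f (x + t *: v)) v).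
Proof.
move=> fx; have eqf : (fun h : R => h^-1 *: (((fun s : R => f (x + s *: v)) \o shift t) (h *: 1)
     - f (x + t *: v))) =
   (fun h : R => h^-1 *: ((f \o shift (x + t *: v)) (h *: v) - f (x + t *: v))).
  apply/funext => h /=; congr (_ *: (f _ - _)).
  by rewrite [h *: 1]mulr1 scalerDl addrCA addrA.
split; first by rewrite /derivable eqf; exact: diff_derivable.
by rewrite /derive eqf -derive_grad.
Qed.

(** Apply the mean value theorem on [0, 1] to [psi], which is f on the segment minus the quadratic t
    a + t^2 b. Its derivative is nonpositive because the Lipschitz bound at time t gives L t |v|^2 =
    2 t b. *)
Lemma descent f (L : R) x v : 0 < L -> smooth L f ->
  f (x + v) <= f x + dot (grad f x) v + L / 2 * dot v v.
Proof.
move=> L0 [df lip].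
pose a := dot (grad f x) v; pose b := L / 2 * dot v v.
pose psi (t : R) := f (x + t *: v) - (t * a + t ^+ 2 * b).
pose dpsi (t : R) := dot (grad f (x + t *: v)) v - (a + (t *+ 2) * b).
have dP (t : R) : is_derive t 1 psi (dpsi t).
  have := derive_line (df (x + t *: v)) => ?.
  rewrite /psi /dpsi; apply: is_deriveB.
  apply: is_derive_eq; rewrite /GRing.scale /= ; ring.
have [|c] := @MVT R psi dpsi 0 1 ltr01 (fun t _ => dP t).
  apply: derivable_within_continuous => t _; exact: (@ex_derive _ _ _ _ _ _ _ (dP t)).
rewrite in_itv /= => /andP[c0 c1].
rewrite /psi /dpsi scale1r scale0r addr0 subr0 mulr1 => E.
have : dot (grad f (x + c *: v) - grad f x) v <= (L * c) * dot v v.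
  apply: dot_le; first by rewrite mulr_gt0.
  have := lip (x + c *: v) x.
  rewrite addrAC subrr add0r => lipc.
  rewrite -!enorm_sq; have : enorm (c *: v) = c * enorm v.
    apply: (@pexpIrn _ 2) => //; rewrite ?nnegrE ?mulr_ge0 ?sqrtr_ge0 ?(ltW c0) //.
    by rewrite exprMn !enorm_sq dotZl dotZr; ring.
  move=> nE; rewrite -exprMn lerXn2r ?nnegrE ?mulr_ge0 ?sqrtr_ge0 ?(ltW c0) ?(ltW L0) //.
  by rewrite -mulrA -nE.
rewrite -scaleN1r dotDl dotZl -/a => le1.
have : c *+ 2 * b = L * c * dot v v by rewrite /b -mulr_natl; field.
move: E; rewrite expr1n expr0n /= -/a -/b; lra.
Qed.

End Descent.

(** * Independence and measurability *)

Section Borel.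
Variables (R : realType) (d : nat) (dT : measure_display) (T : measurableType dT).

(** An open set is the countable union of the boxes it contains with rational centres and radii
    1/(n+1); the preimage of a box is a finite intersection of coordinate events. *)
Lemma open_coord_measurable (X : T -> 'rV[R]_d) (U : set 'rV[R]_d) :
  (forall i, measurable_fun setT (fun t => X t 0 i)) ->
  open U -> measurable (X @^-1` U).
Proof.
move=> mX oU.
pose box (a : 'rV[rat]_d * nat) : set 'rV[R]_d :=
  [set x | forall i, `|ratr (a.1 0 i) - x 0 i| < a.2.+1%:R^-1].
have -> : X @^-1` U = \bigcup_(a in [set a | box a `<=` U]) (X @^-1` box a).
  apply/seteqP; split=> [t Ut|t [a /= aU ta]]; last exact: aU.
  have /nbhs_ballP[e /= e0 eU] : nbhs (X t) U by exact: open_nbhs_nbhs.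
  (* With radius below e / 2, a box whose centre is that close to X t lies in the ball of radius e
     around X t. *)
  have [n nP] : exists n : nat, n.+1%:R^-1 < e / 2.
    exists (Num.truncn (e / 2)^-1); rewrite -[ltRHS]invrK ltf_pV2 ?posrE ?invr_gt0 ?divr_gt0 //.
    by rewrite truncnS_gt.
  have n0 : 0 < n.+1%:R^-1 :> R by rewrite invr_gt0.
  have qP i : exists q : rat, `|ratr q - X t 0 i| < n.+1%:R^-1.
    have [q _ ] : exists2 q, True & ratr q \in `]X t 0 i - n.+1%:R^-1, X t 0 i + n.+1%:R^-1[.
      have [] := @rat_in_itvoo R (X t 0 i - n.+1%:R^-1) (X t 0 i + n.+1%:R^-1).
        by rewrite ltrBlDr -addrA ltr_pwDr // addr_gt0.
      by move=> q qP; exists q.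
    by rewrite in_itv /= => qq; exists q; rewrite ltr_distl.
  have [q qq] := choice qP.
  exists (\row_i q i, n) => /=; last by move=> i; rewrite mxE; exact: qq.
  move=> y yb; apply: eU; split=> // i j; rewrite ord1 /ball /=.
  have := yb j; have := qq j; rewrite /= mxE => h1 h2.
  have := ler_distD (ratr (q j)) (X t 0 j) (y 0 j).
  rewrite [`|X t 0 j - ratr _|]distrC.
  by move: h1 h2 nP; move: (n.+1%:R^-1) => r; lra.
rewrite bigcup_mkcond; apply: countable_bigcupT_measurable => [|a]; first exact: countableP.
case: ifP => // _.
have -> : X @^-1` box a = \bigcap_(i in [set: 'I_d])
    ((fun t => X t 0 i) @^-1` ball (ratr (a.1 0 i) : R) a.2.+1%:R^-1).
  by apply/seteqP; split=> t /= ta i; [move=> _|]; exact: ta.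
apply: fin_bigcap_measurable => // i _; rewrite -[X in measurable X]setTI.
by apply: mX => //; exact: measurable_ball.
Qed.

Lemma continuous_coord_measurable (f : 'rV[R]_d -> R) (X : T -> 'rV[R]_d) :
  continuous f -> (forall i, measurable_fun setT (fun t => X t 0 i)) ->
  measurable_fun setT (fun t => f (X t)).
Proof.
move=> cf mX.
apply: (measurability _ (RGenOpens.measurableE R)).
move=> _ [_ [x [y ->]] <-]; rewrite setTI.
apply: (@open_coord_measurable X (f @^-1` `]x, y[) mX).
by apply: open_comp => [t _|]; [exact: cf|exact: interval_open].
Qed.

End Borel.

Section Independence.
Variables (R : realType) (dT : measure_display) (T : measurableType dT).
Variable P : probability T R.

Section Past.
Variables (J : eqType) (A : J -> set (set T)).
Hypothesis AT : forall j, A j setT.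
Hypothesis AI : forall j, setI_closed (A j).
Hypothesis mA : forall j, A j `<=` measurable.
Hypothesis indepA : mutually_independent P A.

(** A pi-system generating the sigma-algebra of the sources in s. *)
Definition cylinders (s : seq J) : set (set T) :=
  [set E | exists2 Ej : J -> set T, (forall j, j \in s -> A j (Ej j)) &
           E = \bigcap_(j in [set` s]) Ej j].

Lemma cylinders_setI s : setI_closed (cylinders s).
Proof.
move=> _ _ [E hE ->] [E' hE' ->]; exists (fun j => E j `&` E' j).
  by move=> j js; apply: AI; [exact: hE|exact: hE'].
by rewrite bigcapI.
Qed.

Lemma cylinders_sub s j : j \in s -> A j `<=` cylinders s.
Proof.
move=> js E AE; exists (fun j' => if j' == j then E else setT) => [j' _|].
  by case: eqP => [->|].
apply/seteqP; split=> [t Et j' _|t /(_ j js)]; last by rewrite eqxx.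
by case: eqP.
Qed.

Lemma cylindersT s : cylinders s setT.
Proof.
by exists (fun=> setT) => //; apply/seteqP; split.
Qed.

Lemma cylinders_measurable s : cylinders s `<=` measurable.
Proof.
move=> _ [E hE ->]; apply: fin_bigcap_measurable => //.
by move=> j js; apply: mA; exact: hE.
Qed.

Lemma sigma_cylinders_measurable s : <<s cylinders s >> `<=` measurable.
Proof.
apply: smallest_sub; first exact: sigma_algebra_measurable.
exact: cylinders_measurable.
Qed.

(** For fixed B, both sides are finite measures in E. They agree on the pi-system [cylinders s] by
    mutual independence, hence on the sigma-algebra it generates. *)
Lemma past_independent s a E B : uniq (a :: s) ->
  <<s cylinders s >> E -> A a B -> P (E `&` B) = (P E * P B)%E.
Proof.
move=> us sE AB; have mB := mA AB.
have PB0 : 0 <= fine (P B) by rewrite fine_ge0.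
have PBE : P B = (fine (P B))%:E by rewrite fineK // fin_num_measure.
suff -> : P (E `&` B) = mscale (NngNum PB0) P E by rewrite /mscale /= -PBE muleC.
have -> : P (E `&` B) = mrestr P mB E by [].
apply: (g_sigma_algebra_measure_unique (cylinders s) _ (fun=> setT) _ _
  [the measure _ _ of mrestr P mB] [the measure _ _ of mscale (NngNum PB0) P]) => //.
- exact: cylinders_measurable.
- by move=> _; exact: cylindersT.
- by rewrite bigcup_const.
- exact: cylinders_setI.
- move=> _ [Ej hE ->]; rewrite /= /mrestr /mscale /= -PBE.
  have := indepA (E := fun j => if j == a then B else Ej j) us.
  case/andP: us => asn us.
  have h0 j : j \in s -> (if j == a then B else Ej j) = Ej j.
    by case: eqP => // -> ; rewrite (negbTE asn).
  rewrite big_cons eqxx => h.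
  have -> : (\bigcap_(j in [set` s]) Ej j) `&` B =
      \bigcap_(j in [set` a :: s]) (if j == a then B else Ej j).
    apply/seteqP; split=> [t [tE tB] j /=|t tE].
      by rewrite inE => /predU1P[->|js]; rewrite ?eqxx // h0 //; exact: tE.
    split; last by have := tE a; rewrite /= inE eqxx; apply.
    by move=> j js; rewrite -h0 //; apply: tE; rewrite /= inE js orbT.
  rewrite h; last first.
    move=> j; rewrite inE => /predU1P[->|js]; rewrite ?eqxx // h0 //; exact: hE.
  rewrite (indepA (E := Ej) us hE); congr (_ * _)%E.
  by rewrite !big_seq; apply: eq_bigr => j js; rewrite h0.
- move=> _; rewrite /= /mrestr setTI; apply: le_lt_trans (ltry 1).
  exact: probability_le1.
Qed.

End Past.

(** By uniqueness of product measures, the pair of the identity into <<s G>> and xi has law P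
    restricted to <<s G>> times D; change variables and apply Tonelli. *)
Lemma independent_tonelli (G : set (set T)) (d' : measure_display)
    (X : measurableType d') (D : probability X R) (xi : {mfun T >-> X})
    (phi : g_sigma_algebraType G * X -> \bar R) :
  <<s G >> `<=` measurable ->
  (forall E B, <<s G >> E -> measurable B ->
    P (E `&` xi @^-1` B) = (P E * D B)%E) ->
  measurable_fun setT phi -> (forall z, 0 <= phi z)%E ->
  (\int[P]_t phi (t, xi t) = \int[P]_t \int[D]_s phi (t, s))%E.
Proof.
move=> GT indep mphi phi0.
have mid : measurable_fun setT (fun t : T => t : g_sigma_algebraType G).
  by move=> _ Y mY; rewrite setTI; exact: GT.
pose idG : {mfun T >-> g_sigma_algebraType G} :=
  HB.pack (fun t : T => t : g_sigma_algebraType G)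
   (isMeasurableFun.Build _ _ _ _ _ mid).
have mpair : measurable_fun setT (fun t : T => (t : g_sigma_algebraType G, xi t)).
  exact: measurable_fun_pair.
pose pairG : {mfun T >-> (g_sigma_algebraType G * X)%type} :=
  HB.pack (fun t : T => (t : g_sigma_algebraType G, xi t))
   (isMeasurableFun.Build _ _ _ _ _ mpair).
transitivity (\int[distribution P pairG]_z phi z)%E.
  by rewrite ge0_integral_distribution.
transitivity (\int[distribution P idG \x D]_z phi z)%E.
  apply: eq_measure_integral => Y mY _; apply/esym.
  by apply: product_measure_unique => // E B mE mB; exact: indep.
rewrite fubini_tonelli1 // ge0_integral_distribution //.
  exact: measurable_fun_fubini_tonelli_F.
by move=> t; apply: integral_ge0 => s _.
Qed.

End Independence.

Section VectorMeasurability.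
Variables (R : realType) (d : nat) (dT : measure_display) (T : measurableType dT).
Implicit Types X Y : T -> 'rV[R]_d.

Definition mvec X := forall i, measurable_fun setT (fun t => X t 0 i).

Lemma mvec_cst x : mvec (fun=> x).
Proof. by move=> i; exact: measurable_cst. Qed.

Lemma mvecD X Y : mvec X -> mvec Y -> mvec (fun t => X t + Y t).
Proof.
move=> mX mY i; rewrite [X in measurable_fun _ X](_ : _ = (fun t => X t 0 i + Y t 0 i)).
  exact: measurable_funD.
by apply/funext => t; rewrite mxE.
Qed.

Lemma mvecZ a X : mvec X -> mvec (fun t => a *: X t).
Proof.
move=> mX i; rewrite [X in measurable_fun _ X](_ : _ = (fun t => a * X t 0 i)).
  by apply: measurable_funM => //; exact: measurable_cst.
by apply/funext => t; rewrite mxE.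
Qed.

Lemma mvecB X Y : mvec X -> mvec Y -> mvec (fun t => X t - Y t).
Proof.
move=> mX mY; under eq_fun do rewrite -scaleN1r.
by apply: mvecD => //; exact: mvecZ.
Qed.

Lemma mvec_sum (J : eqType) (l : seq J) (X : J -> T -> 'rV[R]_d) :
  (forall j, j \in l -> mvec (X j)) -> mvec (fun t => \sum_(j <- l) X j t).
Proof.
elim: l => [|j l IH] mX.
  by under eq_fun do rewrite big_nil; exact: mvec_cst.
under eq_fun do rewrite big_cons.
apply: mvecD; first by apply: mX; rewrite inE eqxx.
by apply: IH => j' j'l; apply: mX; rewrite inE j'l orbT.
Qed.

Lemma measurable_dot X Y : mvec X -> mvec Y ->
  measurable_fun setT (fun t => dot (X t) (Y t)).
Proof.
move=> mX mY; rewrite /dot; apply: measurable_sum => i.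
exact: measurable_funM.
Qed.

End VectorMeasurability.

Lemma integral_probability_cst (R : realType) (dT : measure_display)
    (T : measurableType dT) (P : probability T R) (a : R) :
  (\int[P]_t cst a%:E t)%E = a%:E.
Proof.
rewrite integral_cst // -[RHS]mule1; congr (_ * _)%E; exact: probability_setT.
Qed.

(** * Convergence of SGD *)

Section Gradients.
Variables (R : realType) (d : nat) (dXi : measure_display) (Xi : measurableType dXi).
Variables (D : probability Xi R) (f : 'rV[R]_d -> R) (L fstar sigma : R).
Variable g : 'rV[R]_d -> Xi -> 'rV[R]_d.
Hypotheses (L0 : 0 < L) (hf : smooth L f) (hfstar : forall x, fstar <= f x).
Hypothesis hg : stochastic_gradient D f sigma g.

Lemma mvec_stochastic_gradient (dT : measure_display) (T : measurableType dT)
    (Y : T -> 'rV[R]_d) (xi : T -> Xi) :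
  mvec Y -> measurable_fun setT xi -> mvec (fun t => g (Y t) (xi t)).
Proof.
move=> mY mxi i; have [mg _ _ _] := hg.
pose F t : d.-tuple R * Xi := ([tuple Y t 0 l | l < d], xi t).
have -> : (fun t => g (Y t) (xi t) 0 i) =
    (fun a : d.-tuple R * Xi => g (\row_l tnth a.1 l) a.2 0 i) \o F.
  apply/funext => t /=; congr (g _ _ _ _).
  by apply/rowP => l; rewrite mxE tnth_mktuple.
apply: measurableT_comp; first exact: mg.
apply: measurable_fun_pair => //; apply/measurable_fun_tnthP => l.
by apply: eq_measurable_fun (mY l) => t _ /=; rewrite tnth_mktuple.
Qed.

Lemma gradE x i : (\int[D]_s (g x s 0 i)%:E)%E = (grad f x 0 i)%:E.
Proof. by have [_ _ + _] := hg => /(_ x i); rewrite unlock. Qed.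

(** By unbiasedness the gradient is a parameter integral of g; its positive and negative parts are
    measurable by Tonelli. *)
Lemma mvec_grad (dT : measure_display) (T : measurableType dT)
    (Y : T -> 'rV[R]_d) : mvec Y -> mvec (fun t => grad f (Y t)).
Proof.
move=> mY i.
pose phi (z : T * Xi) := (g (Y z.1) z.2 0 i)%:E.
have mphi : measurable_fun setT phi.
  apply/measurable_EFinP; apply: mvec_stochastic_gradient.
    by move=> l; apply: (measurableT_comp (mY l)); exact: measurable_fst.
  exact: measurable_snd.
apply/measurable_EFinP.
have -> : EFin \o (fun t => grad f (Y t) 0 i) =
    (fun t => fubini_F D (phi^\+)%E t - fubini_F D (phi^\-)%E t)%E.
  apply/funext => t; rewrite [LHS]/= -gradE [LHS]integralE.
  by congr (_ - _)%E; apply: eq_integral => s _; rewrite ?funeposE ?funenegE.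
apply: emeasurable_funB; apply: measurable_fun_fubini_tonelli_F => //.
  exact: measurable_funepos.
exact: measurable_funeneg.
Qed.

Lemma measurable_objective (dT : measure_display) (T : measurableType dT)
    (Y : T -> 'rV[R]_d) : mvec Y -> measurable_fun setT (fun t => f (Y t)).
Proof.
move=> mY; apply: continuous_coord_measurable => // x.
by apply: differentiable_continuous; have [+ _] := hf; exact.
Qed.

Variables (gam r : R).

(* The upper bound that the descent lemma gives on f - fstar after a step of
   size gam from x along the gradient perturbed by r *: z. *)
Definition gap_bound (x z : 'rV[R]_d) : R :=
  f x - fstar - gam * dot (grad f x) (grad f x + r *: z)
  + L * gam ^+ 2 / 2 * dot (grad f x + r *: z) (grad f x + r *: z).

Lemma gap_le x z : f (x - gam *: (grad f x + r *: z)) - fstar <= gap_bound x z.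
Proof.
have := descent x (- (gam *: (grad f x + r *: z))) L0 hf.
rewrite -scaleNr !(dotZl, dotZr) /gap_bound.
set a := dot _ _; set b := dot _ _.
have -> : L / 2 * (- gam * (- gam * b)) = L * gam ^+ 2 / 2 * b by ring.
lra.
Qed.

(** For any z, the bound dominates the gap at the point actually reached with z. *)
Lemma gap_bound_ge0 x z : 0 <= gap_bound x z.
Proof. by apply: le_trans (gap_le x z); rewrite subr_ge0. Qed.

(** Second-order expansion in the noise: the linear coefficient depends on x and z only, so a fresh
    centred e makes this term vanish in expectation. *)
Lemma gap_boundD x z e : gap_bound x (z + e) = gap_bound x z
  + dot (L * gam ^+ 2 * r *: (grad f x + r *: z) - gam * r *: grad f x) e
  + L * gam ^+ 2 * r ^+ 2 / 2 * dot e e.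
Proof.
rewrite /gap_bound -[- (gam * r *: _)]scaleNr !(dotDl, dotDr, dotZl, dotZr, scalerDr).
rewrite [dot e (grad f x)]dotC [dot e z]dotC [dot z (grad f x)]dotC.
by field.
Qed.

Lemma measurable_gap_bound (dT : measure_display) (T : measurableType dT)
    (Y Z : T -> 'rV[R]_d) : mvec Y -> mvec Z ->
  measurable_fun setT (fun t => gap_bound (Y t) (Z t)).
Proof.
move=> mY mZ; have mG := mvec_grad mY.
have mU : mvec (fun t => grad f (Y t) + r *: Z t) by apply/mvecD/mvecZ.
apply: measurable_funD; [apply: measurable_funB; [apply: measurable_funB|]|].
- exact: measurable_objective.
- exact: measurable_cst.
- by apply: measurable_funM; [exact: measurable_cst|exact: measurable_dot].
- by apply: measurable_funM; [exact: measurable_cst|exact: measurable_dot].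
Qed.

Definition noise x s := g x s - grad f x.

Lemma integrable_noise x i :
  D.-integrable setT (fun s => (noise x s 0 i)%:E) /\
  (\int[D]_s (noise x s 0 i)%:E)%E = 0%E.
Proof.
have [_ ig _ _] := hg.
have ic : D.-integrable setT (cst (- grad f x 0 i)%:E).
  exact: finite_measure_integrable_cst.
have -> : (fun s => (noise x s 0 i)%:E) =
   (fun s => (g x s 0 i)%:E + cst (- grad f x 0 i)%:E s)%E.
  by apply/funext => s; rewrite /noise !mxE EFinD.
split; first by apply: integrableD => //; exact: ig.
rewrite integralD //.
by rewrite gradE integral_probability_cst -EFinD subrr.
Qed.

Lemma integral_gap_bound x z :
  (\int[D]_s (gap_bound x (z + noise x s))%:E <=
   (gap_bound x z + L * gam ^+ 2 * r ^+ 2 / 2 * sigma ^+ 2)%:E)%E.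
Proof.
set c := L * _ * _ / 2.
have c0 : 0 <= c by rewrite /c; rewrite divr_ge0 // mulr_ge0 ?sqr_ge0 // mulr_ge0 ?sqr_ge0 // ltW.
set w := L * gam ^+ 2 * r *: (grad f x + r *: z) - gam * r *: grad f x.
under eq_integral do rewrite gap_boundD -/c -/w !EFinD.
have mnoise : mvec (noise x).
  apply: mvecB; last exact: mvec_cst.
  by apply: mvec_stochastic_gradient => //; exact: mvec_cst.
have mn2 := measurable_dot mnoise mnoise.
have var : (\int[D]_s (dot (noise x s) (noise x s))%:E <= (sigma ^+ 2)%:E)%E.
  have [_ _ _ /(_ x)] := hg; rewrite unlock.
  by under eq_integral do rewrite enorm_sq.
have in2 : D.-integrable setT (fun s => (dot (noise x s) (noise x s))%:E).
  apply/integrableP; split; first exact/measurable_EFinP.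
  under eq_integral do rewrite gee0_abs ?lee_fin ?dot_ge0 //.
  by apply: le_lt_trans var (ltry _).
have dotE : (fun s => (dot w (noise x s))%:E) =
    (fun s => \sum_i ((w 0 i)%:E * (noise x s 0 i)%:E))%E.
  by apply/funext => s; rewrite sumEFin; congr EFin.
have iw i : D.-integrable setT (fun s => (w 0 i)%:E * (noise x s 0 i)%:E)%E.
  by apply: integrableZl => //; case: (integrable_noise x i).
have in1 : D.-integrable setT (fun s => (dot w (noise x s))%:E).
  by rewrite dotE; exact: integrable_sum.
have E1 : (\int[D]_s (dot w (noise x s))%:E)%E = 0%E.
  rewrite dotE integral_sum // big1 // => i _.
  have [iN EN] := integrable_noise x i.
  by rewrite integralZl // EN mule0.
have ic : D.-integrable setT (cst (gap_bound x z)%:E).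
  exact: finite_measure_integrable_cst.
rewrite integralD //=; last 2 first.
- exact: (integrableD _ ic in1).
- under eq_fun do rewrite EFinM. exact: integrableZl.
rewrite integralD // E1 integral_probability_cst adde0.
rewrite -/(gap_bound x z) [leRHS]EFinD leeD2l //; under eq_integral do rewrite EFinM.
rewrite integralZl // [in leRHS]EFinM.
by apply: lee_wpmul2l => //; rewrite lee_fin.
Qed.

Variables (dT : measure_display) (T : measurableType dT) (P : probability T R).

(** Y and Z are measurable for <<s G>>, of which xi is independent. The sample can thus be
    integrated out first with Y t and Z t frozen, where [integral_gap_bound] applies. *)
Lemma one_sample (G : set (set T)) (xi : {mfun T >-> Xi})
    (Y Z : g_sigma_algebraType G -> 'rV[R]_d) :
  <<s G >> `<=` measurable ->
  (forall E B, <<s G >> E -> measurable B ->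
    P (E `&` xi @^-1` B) = (P E * D B)%E) ->
  mvec Y -> mvec Z ->
  (\int[P]_t (gap_bound (Y t) (Z t + noise (Y t) (xi t)))%:E <=
   \int[P]_t (gap_bound (Y t) (Z t))%:E +
   (L * gam ^+ 2 * r ^+ 2 / 2 * sigma ^+ 2)%:E)%E.
Proof.
move=> GT indep mY mZ.
have mid : measurable_fun setT (fun t : T => t : g_sigma_algebraType G).
  by move=> _ A mA; rewrite setTI; exact: GT.
pose phi (a : g_sigma_algebraType G * Xi) :=
  (gap_bound (Y a.1) (Z a.1 + noise (Y a.1) a.2))%:E.
have fstY : mvec (fun a : g_sigma_algebraType G * Xi => Y a.1).
  by move=> l; apply: (measurableT_comp (mY l)); exact: measurable_fst.
have fstZ : mvec (fun a : g_sigma_algebraType G * Xi => Z a.1).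
  by move=> l; apply: (measurableT_comp (mZ l)); exact: measurable_fst.
have mphi : measurable_fun setT phi.
  apply/measurable_EFinP; apply: measurable_gap_bound => //.
  apply: mvecD => //; apply: mvecB; last exact: mvec_grad.
  by apply: mvec_stochastic_gradient => //; exact: measurable_snd.
have phi0 a : (0 <= phi a)%E by rewrite lee_fin gap_bound_ge0.
rewrite (independent_tonelli GT indep mphi phi0).
have mgap : measurable_fun setT (fun t : T => gap_bound (Y t) (Z t)).
  apply: measurable_gap_bound => l.
    exact: (measurableT_comp (mY l) mid).
  exact: (measurableT_comp (mZ l) mid).
have c0 : 0 <= L * gam ^+ 2 * r ^+ 2 / 2 * sigma ^+ 2.
  by rewrite mulr_ge0 ?sqr_ge0 // divr_ge0 // mulr_ge0 ?sqr_ge0 // mulr_ge0 ?sqr_ge0 // ltW.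
apply: (@le_trans _ _ (\int[P]_t ((gap_bound (Y t) (Z t))%:E + (L * gam ^+ 2 * r ^+ 2 / 2 * sigma ^+ 2)%:E))%E).
  apply: ge0_le_integral => //.
  - by move=> t _; apply: integral_ge0 => s _; exact: phi0.
  - apply: (measurableT_comp (f := fubini_F D phi) _ mid).
    exact: measurable_fun_fubini_tonelli_F.
  - by apply: emeasurable_funD; [exact/measurable_EFinP|exact: measurable_cst].
  - by move=> t _; apply: le_trans (integral_gap_bound (Y t) (Z t)) _; rewrite EFinD.
rewrite ge0_integralD //.
- by rewrite integral_probability_cst.
- by move=> t _; rewrite lee_fin gap_bound_ge0.
- exact/measurable_EFinP.
Qed.

End Gradients.

(** * Indices of the samples used by each iteration *)

Section Batches.
Variables (V : finType) (S : {set V}) (B : nat -> V -> nat).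

Definition batch (k : nat) : seq (nat * V * nat) :=
  [seq (k, i, j) | i <- enum S, j <- iota 0 (B k i)].

Fixpoint history (k : nat) : seq (nat * V * nat) :=
  if k is k'.+1 then batch k' ++ history k' else [::].

Lemma big_batch (M : nmodType) k (F : nat * V * nat -> M) :
  \sum_(a <- batch k) F a = \sum_(i in S) \sum_(j < B k i) F (k, i, val j).
Proof.
rewrite big_allpairs_dep /= big_enum /=; apply: eq_bigr => i _.
by rewrite -[iota 0 _]/(iota 0 (B k i)) -[X in iota 0 X]subn0 -/(index_iota 0 (B k i)) big_mkord.
Qed.

Lemma batch_fst k a : a \in batch k -> a.1.1 = k.
Proof. by case/allpairsPdep => i [j [_ _ ->]]. Qed.

Lemma size_batch k : size (batch k) = (\sum_(i in S) B k i)%N.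
Proof.
rewrite -sum1_size (big_batch k (fun=> 1%N)); apply: eq_bigr => i _.
by rewrite sum1_card card_ord.
Qed.

Lemma history_fst k a : a \in history k -> (a.1.1 < k)%N.
Proof.
elim: k => //= k IH; rewrite mem_cat => /orP[/batch_fst ->//|/IH ak].
exact: ltnW.
Qed.

Lemma uniq_history k : uniq (history k).
Proof.
elim: k => //= k IH; rewrite cat_uniq IH andbT; apply/andP; split.
  apply: allpairs_uniq_dep => [|i _|]; rewrite ?enum_uniq ?iota_uniq //.
  by move=> [i j] [i' j'] _ _ /= [-> ->].
apply/hasPn => a /history_fst ak; apply/negP => /batch_fst ak'.
by rewrite ak' ltnn in ak.
Qed.

End Batches.

(** * Expected descent along the iterations *)

Section Convergence.
Variables (R : realType) (d : nat) (dXi : measure_display) (Xi : measurableType dXi).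
Variables (D : probability Xi R) (f : 'rV[R]_d -> R) (L fstar sigma eps : R).
Variable g : 'rV[R]_d -> Xi -> 'rV[R]_d.
Hypotheses (L0 : 0 < L) (hf : smooth L f) (hfstar : forall x, fstar <= f x).
Hypothesis hg : stochastic_gradient D f sigma g.
Variables (V : finType) (S : {set V}) (B : nat -> V -> nat) (x0 : 'rV[R]_d).

(** Only samples of the history enter, and T is arbitrary; so this also gives measurability of x^k
    for the sigma-algebra of its past. *)
Lemma mvec_grace_iter (dT : measure_display) (T : measurableType dT) gam
    (xi : nat -> V -> nat -> T -> Xi) k :
  (forall a, a \in history S B k -> measurable_fun setT (xi a.1.1 a.1.2 a.2)) ->
  mvec (grace_iter g gam x0 S B xi k).
Proof.
elim: k => [|k IH] mxi /=; first exact: mvec_cst.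
have mk : mvec (grace_iter g gam x0 S B xi k).
  by apply: IH => a ak; apply: mxi; rewrite /= mem_cat ak orbT.
apply: mvecB => //; apply: mvecZ.
under eq_fun do rewrite -(big_batch S B k (fun a =>
  g (grace_iter g gam x0 S B xi k _) (xi a.1.1 a.1.2 a.2 _))).
apply: mvec_sum => a ak; apply: (mvec_stochastic_gradient hg) => //.
by apply: mxi; rewrite /= mem_cat ak.
Qed.

Variables (dT : measure_display) (T : measurableType dT) (P : probability T R).
Variables (xi : nat -> V -> nat -> {mfun T >-> Xi}) (M : nat) (I : {mfun T >-> nat}).
Hypothesis hxi : samples_and_index P D xi M I.

Let past (a : option (nat * V * nat)) : set (set T) :=
  match a with
  | None => preimage_set_system [set: T] I measurable
  | Some (k, i, j) => preimage_set_system [set: T] (xi k i j) measurable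
  end.

Let pastT a : past a setT.
Proof.
case: a => [[[k i] j]|] /=; exists setT => //; by rewrite preimage_setT setTI.
Qed.

Let pastI a : setI_closed (past a).
Proof.
case: a => [[[k i] j]|] /= _ _ [E mE <-] [E' mE' <-];
  by exists (E `&` E'); [exact: measurableI|rewrite !setTI preimage_setI].
Qed.

Let mpast a : past a `<=` measurable.
Proof.
case: a => [[[k i] j]|] /= _ [E mE <-].
  exact: (measurable_funPT (xi k i j)).
exact: (measurable_funPT I).
Qed.

Let indep_past : mutually_independent P past.
Proof. by case: hxi. Qed.

Let sig (l : seq (nat * V * nat)) : set (set T) := cylinders past (map Some l).

Let sig_measurable l : <<s sig l >> `<=` measurable.
Proof. exact: sigma_cylinders_measurable. Qed.

Let xi_sig l a : a \in l ->
  measurable_fun setT (xi a.1.1 a.1.2 a.2 : g_sigma_algebraType (sig l) -> Xi).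
Proof.
move=> al _ E mE; apply: sub_sigma_algebra.
apply: (@cylinders_sub _ _ _ past pastT (map Some l) (Some a)); first by rewrite map_f.
by case: a {al} => [[k i] j] /=; exists E.
Qed.

Let indep_xi l a E C : uniq (a :: l) -> <<s sig l >> E -> measurable C ->
  P (E `&` xi a.1.1 a.1.2 a.2 @^-1` C) = (P E * D C)%E.
Proof.
move=> ul sE mC; have [lawD _ _] := hxi.
rewrite -(lawD a.1.1 a.1.2 a.2 C mC).
apply: (past_independent pastT pastI mpast indep_past (s := map Some l) (a := Some a)) => //.
  by rewrite -[Some a :: _]/(map Some (a :: l)) map_inj_uniq // => ? ? [].
by case: a {ul} => [[k i] j] /=; exists C => //; rewrite setTI.
Qed.

Let indep_I l E C : uniq l -> <<s sig l >> E -> measurable C ->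
  P (E `&` I @^-1` C) = (P E * distribution P I C)%E.
Proof.
move=> ul sE mC.
apply: (past_independent pastT pastI mpast indep_past (s := map Some l) (a := None)) => //.
  rewrite /= map_inj_uniq ?ul ?andbT; last by move=> ? ? [].
  by apply/mapP => -[].
by exists C => //; rewrite setTI.
Qed.

Variable gam : R.
Let x k (t : T) := grace_iter g gam x0 S B (fun k i j => xi k i j : T -> Xi) k t.

Let mx k : mvec (x k).
Proof. by apply: mvec_grace_iter => a _; exact: measurable_funPT. Qed.

Variable m : nat.
Hypotheses (m0 : (0 < m)%N) (hB : forall k, (\sum_(i in S) B k i)%N = m).

Let gap := gap_bound f L fstar gam m%:R^-1.
Let var := L * gam ^+ 2 * m%:R^-1 ^+ 2 / 2 * sigma ^+ 2.

(** Each sample is independent of the rest of l and of the history, so [one_sample] strips it off at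
    the price [var]. *)
Let batch_gap k l : uniq (l ++ history S B k) ->
  (\int[P]_t (gap (x k t)
       (\sum_(a <- l) noise f g (x k t) (xi a.1.1 a.1.2 a.2 t)))%:E <=
   \int[P]_t (gap (x k t) 0)%:E + ((size l)%:R * var)%:E)%E.
Proof.
elim: l => [|a l IH] /= ul.
  by under eq_integral do rewrite big_nil; rewrite mul0r adde0.
under eq_integral do rewrite big_cons addrC.
have mY : mvec (x k : g_sigma_algebraType (sig (l ++ history S B k)) -> _).
  apply: mvec_grace_iter => b bk; apply: xi_sig.
  by rewrite mem_cat bk orbT.
have mZ : mvec (fun t : g_sigma_algebraType (sig (l ++ history S B k)) =>
    \sum_(b <- l) noise f g (x k t) (xi b.1.1 b.1.2 b.2 t)).
  apply: mvec_sum => b bl; apply: mvecB; last exact: (mvec_grad hg).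
  apply: (mvec_stochastic_gradient hg) => //; apply: xi_sig.
  by rewrite mem_cat bl.
have := one_sample L0 hf hfstar hg gam m%:R^-1
  (sig_measurable (l := l ++ history S B k)) (fun E C => @indep_xi _ a E C ul) mY mZ.
move/le_trans; apply.
case/andP: ul => _ /IH; rewrite -/var -natr1 mulrDl mul1r EFinD addeA => le1.
exact: leeD2r.
Qed.

Let E_gap k : (\int[P]_t (f (x k.+1 t) - fstar)%:E <=
   \int[P]_t (gap (x k t) 0)%:E + (m%:R * var)%:E)%E.
Proof.
have us : uniq (batch S B k ++ history S B k) := uniq_history S B k.+1.
have := batch_gap us; rewrite size_batch hB; apply: le_trans.
have mR : m%:R != 0 :> R by rewrite pnatr_eq0 -lt0n.
apply: ge0_le_integral => //.
- by move=> t _; rewrite lee_fin subr_ge0.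
- apply/measurable_EFinP; apply: measurable_funB; last exact: measurable_cst.
  exact: (measurable_objective hf).
- apply/measurable_EFinP; apply: (measurable_gap_bound fstar hf hg) => //.
  apply: mvec_sum => a _; apply: mvecB; last exact: (mvec_grad hg).
  apply: (mvec_stochastic_gradient hg) => //; exact: measurable_funPT.
move=> t _; rewrite lee_fin.
(* The batch average equals the gradient plus 1/m times the summed noises, so the update is the step
   in [gap_le] with r = 1/m. *)
apply: le_trans (gap_le fstar L0 hf gam m%:R^-1 _ _).
rewrite lerD2r le_eqVlt; apply/orP; left; apply/eqP; congr f.
rewrite {1}/x /= -/(x k t); congr (_ - _).
rewrite hB -(big_batch S B k (fun a => g (x k t) (xi a.1.1 a.1.2 a.2 t))).
rewrite -scalerA; congr (_ *: _).
rewrite /noise big_split /= sumrN big_const_seq count_predT iter_addr_0 size_batch hB.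
by rewrite scalerDr scalerN -[grad f _ *+ m]scaler_nat scalerA mulVf // scale1r
  addrCA subrr addr0.
Qed.

Hypotheses (gamE : gam = 1 / (2 * L)) (eps0 : 0 < eps).
Hypothesis m_eps : sigma ^+ 2 / eps <= m%:R.

Let gsq k t := dot (grad f (x k t)) (grad f (x k t)).

Let mgsq k : measurable_fun setT (gsq k).
Proof. by apply: measurable_dot; exact: (mvec_grad hg). Qed.

(** The coefficient is gam - L gam^2 / 2 = 1/(2L) - 1/(8L). The sum form avoids subtracting
    integrals that might be infinite. *)
Let E_gap0 k : (\int[P]_t (gap (x k t) 0)%:E +
    (3 / (8 * L))%:E * \int[P]_t (gsq k t)%:E =
  \int[P]_t (f (x k t) - fstar)%:E)%E.
Proof.
have L8 : 0 <= 3 / (8 * L) by rewrite divr_ge0 // mulr_ge0 // ltW.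
rewrite -ge0_integralZl_EFin //; last 2 first.
- by move=> t _; rewrite lee_fin dot_ge0.
- exact/measurable_EFinP.
rewrite -ge0_integralD //.
- apply: eq_integral => t _; rewrite -EFinM -EFinD; congr EFin.
  rewrite /gap /gap_bound scaler0 addr0 -/(gsq k t) gamE; field.
  exact: lt0r_neq0.
- by move=> t _; rewrite lee_fin gap_bound_ge0.
- by apply/measurable_EFinP; apply: (measurable_gap_bound fstar hf hg).
- by move=> t _; rewrite -EFinM lee_fin mulr_ge0 // dot_ge0.
- by apply/measurable_EFinP; apply: measurable_funM => //; exact: measurable_cst.
Qed.

Let E_descent k : (\int[P]_t (f (x k.+1 t) - fstar)%:E +
    (3 / (8 * L))%:E * \int[P]_t (gsq k t)%:E <=
  \int[P]_t (f (x k t) - fstar)%:E + (eps / (8 * L))%:E)%E.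
Proof.
rewrite -(E_gap0 k) addeAC; apply: leeD2r.
apply: le_trans (E_gap k) _; apply: leeD2l; rewrite lee_fin /var gamE.
have m0R : 0 < m%:R :> R by rewrite ltr0n.
(* The m samples together cost sigma^2 / (8 L m), at most eps / (8 L) by the choice of m. *)
have -> : m%:R * (L * (1 / (2 * L)) ^+ 2 * m%:R^-1 ^+ 2 / 2 * sigma ^+ 2) =
    sigma ^+ 2 / m%:R / (8 * L).
  by field; rewrite !lt0r_neq0.
rewrite ler_wpM2r ?invr_ge0 ?mulr_ge0 ?(ltW L0) //.
by rewrite ler_pdivrMr // mulrC -ler_pdivrMr.
Qed.

Let E_telescope k : (\int[P]_t (f (x k t) - fstar)%:E +
    (3 / (8 * L))%:E * \sum_(i < k) \int[P]_t (gsq i t)%:E <=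
  (f x0 - fstar + k%:R * (eps / (8 * L)))%:E)%E.
Proof.
have L8 : 0 <= 3 / (8 * L) by rewrite divr_ge0 // mulr_ge0 // ltW.
have gsq0 i : (0 <= \int[P]_t (gsq i t)%:E)%E.
  by apply: integral_ge0 => t _; rewrite lee_fin dot_ge0.
elim: k => [|k IH].
  rewrite big_ord0 mule0 adde0 mul0r addr0.
  by rewrite (integral_probability_cst P (f x0 - fstar)).
rewrite big_ord_recr /= ge0_muleDr ?sume_ge0 //.
rewrite [((3 / (8 * L))%:E * _ + _)%E]addeC addeA.
apply: le_trans (leeD2r _ (E_descent k)) _.
rewrite addeAC -[k.+1%:R]natr1 (mulrDl k%:R) mul1r addrA [leRHS]EFinD.
exact: leeD2r.
Qed.

Hypotheses (M0 : (0 < M)%N) (M_eps : 4 * L * (f x0 - fstar) / eps <= M%:R).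

Let sum_gsq : (\sum_(k < M) \int[P]_t (gsq k t)%:E <= (M%:R * eps)%:E)%E.
Proof.
have L8 : 0 < 3 / (8 * L) by rewrite divr_gt0 // mulr_gt0.
have : ((3 / (8 * L))%:E * \sum_(i < M) \int[P]_t (gsq i t)%:E <=
    (f x0 - fstar + M%:R * (eps / (8 * L)))%:E)%E.
  apply: le_trans (E_telescope M); rewrite leeDr //.
  by apply: integral_ge0 => t _; rewrite lee_fin subr_ge0.
rewrite muleC -lee_pdivlMr // => /le_trans; apply.
rewrite -EFinM lee_fin ler_pdivrMr //.
have : f x0 - fstar <= M%:R * eps / (4 * L).
  rewrite ler_pdivlMr ?mulr_gt0 // mulrC -ler_pdivrMr //.
move=> le1.
(* Two thirds of the budget pay for the initial gap, by the choice of M, and one third for the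
   noise. *)
have -> : M%:R * eps * (3 / (8 * L)) = M%:R * eps / (4 * L) + M%:R * (eps / (8 * L)).
  by field; exact: lt0r_neq0.
by rewrite lerD2r.
Qed.

(** * The random index *)

Let measurable_index (A : set nat) : measurable (I @^-1` A).
Proof. by rewrite -[X in measurable X]setTI; exact: (measurable_funPT I). Qed.

Let index_eq k : measurable (I @^-1` [set k]).
Proof. exact: measurable_index. Qed.

Let index_bigcup :
  I @^-1` `I_M = \big[setU/set0]_(k <- iota 0 M) (I @^-1` [set k]).
Proof.
rewrite -[M in iota 0 M]subn0 -/(index_iota 0 M) big_mkord
  -(bigcup_mkord M (fun k => I @^-1` [set k])).
by apply/seteqP; split=> [t /= tM|t [k /= kM ->]] //; exists (I t).
Qed.

(** The law of I is prescribed only at 0, ..., M-1, but these M atoms of mass 1/M already have total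
    mass 1. *)
Let index_out0 : P (I @^-1` (~` `I_M)) = 0%E.
Proof.
have [_ lawI _] := hxi.
rewrite preimage_setC probability_setC; last exact: (measurable_index `I_M).
have -> : P (I @^-1` `I_M) = 1%E; last by rewrite subee.
rewrite index_bigcup -[M in iota 0 M]subn0 -/(index_iota 0 M) big_mkord.
rewrite (measure_bigsetU P (F := fun k => I @^-1` [set k]) index_eq).
  rewrite (eq_bigr (fun=> (M%:R^-1)%:E)) => [|k _]; last exact: lawI.
  rewrite sumEFin sumr_const card_ord -[_ *+ M]mulr_natl divff //.
  by rewrite pnatr_eq0 -lt0n.
exact: trivIset_preimage1.
Qed.

Let mgsq_index : measurable_fun setT (fun t => (gsq (I t) t)%:E).
Proof.
have IT : \bigcup_k (I @^-1` [set k]) = setT by rewrite -preimage_bigcup bigcup_imset1 image_id.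
rewrite -IT; apply/measurable_fun_bigcup => // k.
apply: (eq_measurable_fun (fun t => (gsq k t)%:E)).
  by move=> t; rewrite inE /= => ->.
by apply/measurable_EFinP; apply: measurable_funS (mgsq k).
Qed.

(** x^k is determined by its history, of which I is independent; integrating out the indicator of I
    = k leaves the factor 1/M. *)
Let E_index k : (k < M)%N ->
  (\int[P]_(t in I @^-1` [set k]) (gsq (I t) t)%:E =
   (M%:R^-1)%:E * \int[P]_t (gsq k t)%:E)%E.
Proof.
move=> kM; have [_ lawI _] := hxi.
pose G := sig (history S B k).
pose phi (a : g_sigma_algebraType G * nat) : \bar R :=
  ((gsq k a.1)%:E * (\1_[set k] a.2)%:E)%E.
transitivity (\int[P]_t phi (t, I t))%E.
  rewrite integral_mkcond; apply: eq_integral => t _.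
  rewrite /phi patchE /= indicE; have [Itk|] := eqVneq (I t) k.
    by rewrite !mem_set //= mule1 Itk.
  by move=> /eqP nk; rewrite !memNset // /= mule0.
have mphi : measurable_fun setT phi.
  apply: emeasurable_funM; apply/measurable_EFinP.
    have mY : mvec (x k : g_sigma_algebraType G -> _).
      by apply: mvec_grace_iter => b bk; exact: xi_sig.
    apply: (measurableT_comp (f := fun t : g_sigma_algebraType G => gsq k t)) => //.
    by apply: measurable_dot; exact: (mvec_grad hg).
  by apply: measurableT_comp.
rewrite (independent_tonelli (sig_measurable (l := history S B k))
  (fun E C => @indep_I _ E C (uniq_history S B k)) mphi); last first.
  by move=> z; rewrite mule_ge0 // lee_fin ?dot_ge0.
rewrite -ge0_integralZl_EFin //; last 2 first.
- by move=> t _; rewrite lee_fin dot_ge0.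
- exact/measurable_EFinP.
apply: eq_integral => t _; rewrite /phi /= ge0_integralZl_EFin ?dot_ge0 //.
  by rewrite integral_indic // setIT muleC; congr (_ * _)%E; exact: lawI.
Qed.

Lemma grace_stationary : stationary P f eps (fun t => x (I t) t).
Proof.
rewrite /stationary unlock.
rewrite (eq_integral (fun t => (gsq (I t) t)%:E)); last first.
  by move=> t _; rewrite enorm_sq.
have gsq0 t : (0 <= (gsq (I t) t)%:E)%E by rewrite lee_fin dot_ge0.
rewrite (ge0_negligible_integral (measurable_index (~` `I_M))) //.
rewrite setTD -preimage_setC setCK index_bigcup.
rewrite ge0_integral_bigsetU ?iota_uniq //; last 2 first.
- exact: trivIset_preimage1.
- exact: measurable_funS mgsq_index.
rewrite -[M in iota 0 M]subn0 -/(index_iota 0 M) big_mkord.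
rewrite (eq_bigr (fun k : 'I_M => (M%:R^-1)%:E * \int[P]_t (gsq k t)%:E)%E); last first.
  by move=> k _; exact: E_index.
rewrite -ge0_sume_distrr; last first.
  by move=> k _; apply: integral_ge0 => t _; rewrite lee_fin dot_ge0.
by rewrite muleC lee_pdivrMr ?ltr0n // -EFinM mulrC sum_gsq.
Qed.

End Convergence.

(* c0: approximation factor of the Steiner tree packing; C: constant of the
   big-O. *)
Theorem corollary1p6 (R : realType) (c0 : R) :
  exists2 C : R, 0 < C &
  forall
    (* the problem *)
    (d : nat) (f : 'rV[R]_d -> R) (L fstar : R) (x0 : 'rV[R]_d)
    (hL : 0 < L) (hf : smooth L f) (hfstar : forall x, fstar <= f x)
    (* the stochastic gradients *)
    (dXi : measure_display) (Xi : measurableType dXi) (D : probability Xi R)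
    (g : 'rV[R]_d -> Xi -> 'rV[R]_d) (sigma eps : R)
    (hg : stochastic_gradient D f sigma g) (heps : 0 < eps)
    (* the workers 0, ..., n-1, with their computation times *)
    (n : nat) (h : 'I_n -> R) (h0 : R)
    (hn : (0 < n)%N) (hpos : forall i, 0 < h i) (hh : forall i, h i = h0)
    (* the network, with rational bandwidths of common denominator q *)
    (b : 'I_n -> 'I_n -> R) (mult : 'I_n -> 'I_n -> nat) (q : nat)
    (hb : network b) (hq : (0 < q)%N)
    (hmult : forall i j, b i j = (mult i j)%:R / q%:R)
    (* the preprocessing procedure *)
    (F : {set {set 'I_n}}) (w : {set 'I_n} -> R) (es : seq {set 'I_n})
    (hT : gomory_hu_tree b F w) (hes : sorted_edges F w es)
    (kstar : nat) (S : {set 'I_n})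
    (hS : preprocessing_output d h sigma eps F w es kstar S)
    (* the Steiner tree packing and the AllReduce *)
    (v : 'I_n) (p : nat)
    (NT : 'I_p -> {set 'I_n}) (FT : 'I_p -> {set {set 'I_n}})
    (copy : 'I_p -> {set 'I_n} -> nat) (tcomm : R)
    (hv : v \in S)
    (hp : (1 < #|S|)%N ->
      [/\ steiner_packing mult S NT FT copy,
          (* p is the min S-cut of the multigraph, q * alpha(S), up to c0 *)
          q%:R * steiner_mincut b S <= c0 * p%:R
          (* d is large *)
        & (n * p <= d)%N])
    (htcomm : allreduce_time q%:R d S v NT FT tcomm)
    (* the batches *)
    (B : nat -> 'I_n -> nat) (tcomp : nat -> R)
    (hB : forall k, batch_collected h S (maxn (ceiln (sigma ^+ 2 / eps)) 1)
                                    (B k) (tcomp k)),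
    let Delta := f x0 - fstar in
    let K := ceiln (4%:R * L * Delta / eps) in
    forall
    (* the randomness; the maximum only matters for Delta = 0, where K = 0 and
       the output is x0 *)
    (dT : measure_display) (T : measurableType dT) (P : probability T R)
    (xi : nat -> 'I_n -> nat -> {mfun T >-> Xi}) (I : {mfun T >-> nat})
    (hxi : samples_and_index P D xi (maxn K 1) I),
    let gamma := 1 / (2%:R * L) in
    let x := grace_iter g gamma x0 S B
               (fun k i j => xi k i j : T -> Xi) in
    let bound :=
      minimum [set k : nat | (1 <= k <= n)%N] (fun k =>
        d%:R * inv_wbar w es k
        + minimum [set S' | S' \in level F es k]
            (fun S' : {set 'I_n} => h0 * sigma ^+ 2 / (#|S'|%:R * eps)))
        * (L * Delta / eps)
      + h0 * L * Delta / eps in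
    (* the method finds an eps-stationary point after K iterations *)
    stationary P f eps (fun t => x (I t) t) /\
    (* time until the last of x^0, ..., x^(K-1) is available *)
    grace_time tcomp tcomm K.-1 <= C * bound /\
    (* time of K full iterations; for 4 L Delta < eps one has K <= 1 and the
       output is x0, available without any iteration *)
    (eps <= 4%:R * L * Delta -> grace_time tcomp tcomm K <= C * bound).

Proof.
(* The factor 1 + 6 |c0| is the cost of one iteration relative to [level_cost]; 8 bounds the number
   of timed iterations by 8 y, where y is L Delta / eps. *)
exists (8 * (1 + 6 * `|c0|)); first by rewrite mulr_gt0 // ltr_pwDl // mulr_ge0.
move=> d f L fstar x0 hL hf hfstar dXi Xi D g sigma eps hg heps n h h0 hn hpos hh
  b mult q hb hq hmult F w es hT hes kstar S hS v p NT FT copy tcomm hv hp htcomm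
  B tcomp hB Delta K dT T P xi I hxi gamma x bound.
have h00 : 0 < h0 by rewrite -(hh v).
have D0 : 0 <= Delta by rewrite subr_ge0.
set y := L * Delta / eps.
have y0 : 0 <= y by rewrite divr_ge0 ?mulr_ge0 // ltW.
have yE : 4%:R * L * Delta / eps = 4 * y by rewrite /y !mulrA.
have Kge : 4 * y <= K%:R by rewrite -yE ceiln_ge // yE mulr_ge0.
have Kle : K%:R <= 4 * y + 1 by rewrite -yE ceiln_le // yE mulr_ge0.
split.
  apply: (grace_stationary hL hf hfstar hg hxi (m := maxn (ceiln (sigma ^+ 2 / eps)) 1)) => //.
  - by rewrite leq_max orbT.
  - by move=> k; case: (hB k).
  - apply: (@le_trans _ _ (ceiln (sigma ^+ 2 / eps))%:R); last by rewrite ler_nat leq_maxl.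
    by rewrite ceiln_ge // divr_ge0 ?sqr_ge0 // ltW.
  - by rewrite leq_max orbT.
  - by rewrite -/Delta yE (le_trans Kge) // ler_nat leq_maxl.
have uniq_size (t : seq 'I_n) : uniq t -> (size t <= n)%N.
  by move=> /card_uniqP <-; rewrite -[leqRHS]card_ord max_card.
have [/andP[k1 _] Sk _] := hS.
pose A := (1 + 6 * `|c0|) * level_cost d h sigma eps w es kstar S.
have tA k : tcomp k + tcomm <= A.
  exact: (iteration_time_le uniq_size h00 hh heps hb hq hT hes k1 Sk hv hp htcomm (hB k)).
have c1 : 0 <= 1 + 6 * `|c0| by rewrite addr_ge0 // mulr_ge0.
have lc0 : 0 <= level_cost d h sigma eps w es kstar S.
  rewrite (level_cost_const _ h00 hh heps) ?(level_neq0 Sk) //.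
  rewrite !addr_ge0 ?(ltW h00) //; first by rewrite mulr_ge0 // (inv_wbar_ge0 hb hT hes).
  by apply: divr_ge0; rewrite mulr_ge0 ?sqr_ge0 ?ler0n ?(ltW h00) ?(ltW heps).
(* The additive h0 of [level_cost_le], times y, is the last term of [bound]. *)
have bA : A * y <= (1 + 6 * `|c0|) * bound.
  rewrite -mulrA ler_wpM2l // /bound.
  have -> : h0 * L * Delta / eps = h0 * y by rewrite /y !mulrA.
  rewrite -mulrDl ler_wpM2r //.
  have := level_cost_le h00 hh heps hb hT hes _ hS; rewrite card_ord; exact.
have time k : k%:R <= 8 * y -> grace_time tcomp tcomm k <= 8 * (1 + 6 * `|c0|) * bound.
  move=> ky; apply: le_trans (grace_time_le k tA) _.
  apply: (@le_trans _ _ (8 * y * A)); first by rewrite ler_wpM2r // mulr_ge0.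
  by rewrite -mulrA -[leRHS]mulrA ler_wpM2l // [y * A]mulrC.
split=> [|epsle]; apply: time.
  (* For K > 0 the predecessor cancels the rounding: K - 1 <= 4 y. *)
  have [->|K0] := posnP K; first by rewrite mulr_ge0.
  by move: Kle; rewrite -{1}(prednK K0) -natr1; lra.
(* Now the rounding is absorbed: K <= 4 y + 1 <= 8 y. *)
have : 1 <= 4 * y by rewrite -yE ler_pdivlMr // mul1r.
lra.
Qed.
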